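(* Let $X_1,X_2,\dots$ be random variables such that for each $i\ge1$, $X_i\in\mathcal H_i$, $X_i$ is independent of $\mathcal F_{i-1}$, all $X_i$ are identically distributed, and $$\sum_{m=1}^\infty\mathcal E\big(|X_1|I_{\{m-1<|X_1|\le m\}}\big)<\infty.$$ Let $S_n:=X_1+\cdots+X_n$. Then: (i) if $\mathcal E(X_1)=-\mathcal E(-X_1)$, then $S_n/n\to\mathcal E(X_1)$ quasi-surely; (ii) if $S_n/n$ converges quasi-surely to some $X\in\mathcal H$ and Assumption (A) holds, then $\mathcal E(X_1)=-\mathcal E(-X_1)$ and $X=\mathcal E(X_1)$ q.s.
   Context: Standing setting. $(\Omega,\mathcal F)$ is a measurable space with a discrete-time filtration $(\mathcal F_t)_{t\in\mathbb N}$, $\mathcal F_0$ trivial and $\mathcal F=\sigma(\bigcup_t\mathcal F_t)$. $\mathcal H$ is a linear space of $\mathcal F$-measurable real functions on $\Omega$ containing the constants, such that $X\in\mathcal H$ implies $|X|\in\mathcal H$ and $I_AX\in\mathcal H$ for all $A\in\mathcal F$; $\mathcal H_t:=\{X\in\mathcal H: X \text{ is } \mathcal F_t\text{-measurable}\}$. $(\mathcal E_t)$ is an $\mathcal{SL}$-expectation (a family of maps $\mathcal E_t:\mathcal H\to\mathcal H_t$ that are monotone, time-consistent $\mathcal E_s\circ\mathcal E_t=\mathcal E_s$ for $s\le t$, satisfy $\mathcal E_t(I_AY)=I_A\mathcal E_t(Y)$ for $A\in\mathcal F_t$, $\mathcal E_t(Y)=Y$ for $Y\in\mathcal H_t$,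 are subadditive, satisfy $\mathcal E_t(\lambda Y)=\lambda^+\mathcal E_t(Y)+\lambda^-\mathcal E_t(-Y)$ for $\lambda\in\mathcal H_t$, and $\mathcal E_0(X_i)\to0$ whenever $X_i\downarrow0$ pointwise); $\mathcal E:=\mathcal E_0$; $\mathbb V(A):=\mathcal E(I_A)$. ''Quasi-surely'' (q.s.) means outside a set $N$ with $\mathcal E(I_N)=0$. Independence: $Y\in\mathcal H$ is independent of $Z=(Z_1,\dots,Z_k)$ under $\mathcal E$ if for every measurable $\varphi$ with $\varphi(Z,Y)\in\mathcal H$ and $\varphi(z,Y)\in\mathcal H$ for all $z$, $\mathcal E[\varphi(Z,Y)]=\mathcal E[\bar\varphi(Z)]$ with $\bar\varphi(z):=\mathcal E[\varphi(z,Y)]$; $X$ is independent of $\mathcal F_n$ if $X$ is independent of $I_A$ for every $A\in\mathcal F_n$. $X,Y$ are identically distributed if $\mathcal E[\varphi(X)]=\mathcal E[\varphi(Y)]$ for every $\varphi$ with $\varphi(X),\varphi(Y)\in\mathcal H$. Assumption (A): for any sequence $(Y_n)_{n\in\mathbb N}$ of random variables and any $B\in\sigma(Y_n,n\in\mathbb N)$ there exist $B_n\in\sigma(Y_1,\dots,Y_n)$ with $\lim_{n\to\infty}\mathbb V(B_n\triangle B)=0$, where $B_n\triangle B=(B_n\setminus B)\cup(B\setminus B_n)$. *)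

(* Defs.v *)
From Stdlib Require Import Reals Lra ClassicalEpsilon.
Open Scope R_scope.

Definition is_sigma_algebra {T : Type} (S : (T -> Prop) -> Prop) : Prop :=
  S (fun _ => True) /\
  (forall A, S A -> S (fun w => ~ A w)) /\
  (forall A : nat -> T -> Prop, (forall n, S (A n)) -> S (fun w => exists n, A n w)).

Definition sigma_gen {T : Type} (G : (T -> Prop) -> Prop) (A : T -> Prop) : Prop :=
  forall S, is_sigma_algebra S -> (forall B, G B -> S B) -> S A.

Definition borel : (R -> Prop) -> Prop :=
  sigma_gen (fun A => exists a : R, A = (fun x => x <= a)).
Definition borel2 : (R * R -> Prop) -> Prop :=
  sigma_gen (fun A => exists a b : R, A = (fun p => fst p <= a /\ snd p <= b)).

Definition measurable {T : Type} (S : (T -> Prop) -> Prop) (f : T -> R) : Prop :=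
  forall r : R, S (fun w => f w <= r).

Definition borel_fun (phi : R -> R) : Prop := measurable borel phi.
Definition borel_fun2 (phi : R -> R -> R) : Prop :=
  measurable borel2 (fun p => phi (fst p) (snd p)).

Definition indic {T : Type} (A : T -> Prop) (w : T) : R :=
  if excluded_middle_informative (A w) then 1 else 0.

Definition symdiff {T : Type} (A B : T -> Prop) : T -> Prop :=
  fun w => (A w /\ ~ B w) \/ (B w /\ ~ A w).

Definition filtration {Om : Type} (F : (Om -> Prop) -> Prop)
  (Ft : nat -> (Om -> Prop) -> Prop) : Prop :=
  (forall t, is_sigma_algebra (Ft t)) /\
  (forall s t A, (s <= t)%nat -> Ft s A -> Ft t A) /\
  (forall A, Ft 0%nat A -> (forall w, ~ A w) \/ (forall w, A w)) /\
  (forall A, F A <-> sigma_gen (fun B => exists t, Ft t B) A).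

Definition is_space {Om : Type} (F : (Om -> Prop) -> Prop) (H : (Om -> R) -> Prop) : Prop :=
  (forall X, H X -> measurable F X) /\
  (forall c : R, H (fun _ => c)) /\
  (forall X Y, H X -> H Y -> H (fun w => X w + Y w)) /\
  (forall (a : R) X, H X -> H (fun w => a * X w)) /\
  (forall X, H X -> H (fun w => Rabs (X w))) /\
  (forall A X, F A -> H X -> H (fun w => indic A w * X w)).

Definition Ht {Om : Type} (Ft : nat -> (Om -> Prop) -> Prop) (H : (Om -> R) -> Prop)
  (t : nat) (X : Om -> R) : Prop := H X /\ measurable (Ft t) X.

(* SL-expectation; E t is meaningful on H only (values outside H are irrelevant) *)
Definition SL_expectation {Om : Type} (Ft : nat -> (Om -> Prop) -> Prop)
  (H : (Om -> R) -> Prop) (E : nat -> (Om -> R) -> (Om -> R)) : Prop :=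
  (forall t X, H X -> Ht Ft H t (E t X)) /\
  (forall t X Y, H X -> H Y -> (forall w, X w <= Y w) -> forall w, E t X w <= E t Y w) /\
  (forall s t X, (s <= t)%nat -> H X -> forall w, E s (E t X) w = E s X w) /\
  (forall t A Y, Ft t A -> H Y ->
     forall w, E t (fun w' => indic A w' * Y w') w = indic A w * E t Y w) /\
  (forall t Y, Ht Ft H t Y -> forall w, E t Y w = Y w) /\
  (forall t X Y, H X -> H Y -> forall w, E t (fun w' => X w' + Y w') w <= E t X w + E t Y w) /\
  (forall t l Y, Ht Ft H t l -> H Y -> forall w,
     E t (fun w' => l w' * Y w') w
     = Rmax (l w) 0 * E t Y w + Rmax (- l w) 0 * E t (fun w' => - Y w') w) /\
  (forall Xs : nat -> Om -> R, (forall i, H (Xs i)) ->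
     (forall i w, Xs (S i) w <= Xs i w) -> (forall w, Un_cv (fun i => Xs i w) 0) ->
     forall w, Un_cv (fun i => E 0%nat (Xs i) w) 0).

Definition capV {Om : Type} (E : nat -> (Om -> R) -> (Om -> R)) (A : Om -> Prop) : Om -> R :=
  E 0%nat (indic A).

Definition qs {Om : Type} (F : (Om -> Prop) -> Prop) (E : nat -> (Om -> R) -> (Om -> R))
  (P : Om -> Prop) : Prop :=
  exists N : Om -> Prop, F N /\ (forall w, capV E N w = 0) /\ (forall w, ~ N w -> P w).

(* Y independent of (one-dimensional) Z under E.  E_0 is constant (F_0 trivial),
   so the scalar phibar(z) = E[phi(z,Y)] is read off at the evaluation point w. *)
Definition indep {Om : Type} (H : (Om -> R) -> Prop) (E : nat -> (Om -> R) -> (Om -> R))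
  (Y Z : Om -> R) : Prop :=
  forall phi : R -> R -> R, borel_fun2 phi ->
    H (fun w => phi (Z w) (Y w)) -> (forall z, H (fun w => phi z (Y w))) ->
    forall w, E 0%nat (fun w' => phi (Z w') (Y w')) w
              = E 0%nat (fun w' => E 0%nat (fun w'' => phi (Z w') (Y w'')) w) w.

Definition indep_sigma {Om : Type} (H : (Om -> R) -> Prop) (E : nat -> (Om -> R) -> (Om -> R))
  (X : Om -> R) (G : (Om -> Prop) -> Prop) : Prop :=
  forall A, G A -> indep H E X (indic A).

Definition ident_distr {Om : Type} (H : (Om -> R) -> Prop) (E : nat -> (Om -> R) -> (Om -> R))
  (X Y : Om -> R) : Prop :=
  forall phi : R -> R, borel_fun phi ->
    H (fun w => phi (X w)) -> H (fun w => phi (Y w)) ->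
    forall w, E 0%nat (fun w' => phi (X w')) w = E 0%nat (fun w' => phi (Y w')) w.

Definition assumption_A {Om : Type} (F : (Om -> Prop) -> Prop)
  (E : nat -> (Om -> R) -> (Om -> R)) : Prop :=
  forall Y : nat -> Om -> R, (forall n, measurable F (Y n)) ->
  forall B, sigma_gen (fun A => exists n (r : R), A = (fun w => Y n w <= r)) B ->
  exists Bn : nat -> Om -> Prop,
    (forall n, sigma_gen (fun A => exists k (r : R), (k <= n)%nat /\ A = (fun w => Y k w <= r)) (Bn n)) /\
    (forall w, Un_cv (fun n => capV E (symdiff (Bn n) B) w) 0).

(* Main.v *)
(** The expectation at time 0 is a number-valued sublinear functional [e], continuous along sequences decreasing to 0.

Upper bound: round [X_i] up to a grid of mesh [d] and truncate it at [i + 1]; quasi-surely this changes only finitely many terms of the sum by more than [d], since the shell condition makes the capacities of [|X_i| > i + 1] summable. The centred rounded variables [Z_i] satisfy [e (I_A Z_i) <= 0] for every [A] in [F_i], hence [e (L Z_i) <= 0] for every finite-valued [F_i]-measurable [L >= 0]. This is all that a stopped Hajek-Renyi argument for the square of the positive part of the partial sums needs, and it bounds the limsup of [S_n / n] by [e X_1] quasi-surely. Part (i) follows by applying this to [X] and [-X].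

Part (ii): independence gives [E_i (X_(i+1)) >= e X_1] quasi-surely, so [e (I_A (S_(n+m) - S_n)) >= m (e X_1) V(A)] for [A] in [F_n] when [e X_1 >= 0]. If [e X_1 > 0], Assumption (A) approximates [B = {limsup S_n / n <= 0}] by such sets [A], on which the left side is [o(m)] up to a small error; hence [V(B) = 0]. Translating [X], a quasi-sure limit is at least [e X_1], and by symmetry at most [- e (- X_1)], which never exceeds [e X_1]. *)

Require Import Defs.
From Stdlib Require Import Reals Lra Lia List Compare_dec.
From Stdlib Require Import ClassicalEpsilon FunctionalExtensionality PropExtensionality.
Open Scope R_scope.

(** * Sigma-algebras and measurable functions *)

Lemma set_ext {T : Type} (A B : T -> Prop) : (forall x, A x <-> B x) -> A = B.
Proof.
  intros h; apply functional_extensionality; intros x.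
  apply propositional_extensionality, h.
Qed.

Lemma sa_ext {T} (S : (T -> Prop) -> Prop) (A B : T -> Prop) :
  S A -> (forall w, A w <-> B w) -> S B.
Proof. intros hA h; rewrite <- (set_ext A B h); exact hA. Qed.

Lemma sigma_gen_sa {T} (G : (T -> Prop) -> Prop) : is_sigma_algebra (sigma_gen G).
Proof.
  split; [|split].
  - intros S HS _; apply HS.
  - intros A hA S HS hG; apply HS; exact (hA S HS hG).
  - intros A hA S HS hG; apply HS; intros n; exact (hA n S HS hG).
Qed.

Lemma sigma_gen_base {T} (G : (T -> Prop) -> Prop) A : G A -> sigma_gen G A.
Proof. intros h S _ hG; exact (hG A h). Qed.

Lemma sigma_gen_sub {T} (G : (T -> Prop) -> Prop) S A :
  is_sigma_algebra S -> (forall B, G B -> S B) -> sigma_gen G A -> S A.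
Proof. intros HS hG hA; exact (hA S HS hG). Qed.

Section SigmaAlgebra.
Context {T : Type} {S : (T -> Prop) -> Prop} (HS : is_sigma_algebra S).

Lemma sa_compl A : S A -> S (fun w => ~ A w).
Proof. apply HS. Qed.

Lemma sa_cunion (A : nat -> T -> Prop) : (forall n, S (A n)) -> S (fun w => exists n, A n w).
Proof. apply HS. Qed.

Lemma sa_const (P : Prop) : S (fun _ => P).
Proof.
  destruct (classic P) as [h|h].
  - apply (sa_ext S (fun _ => True)); [apply HS|tauto].
  - apply (sa_ext S (fun _ => ~ True)); [apply sa_compl, HS|tauto].
Qed.

Lemma sa_or A B : S A -> S B -> S (fun w => A w \/ B w).
Proof.
  intros hA hB.
  apply (sa_ext S (fun w => exists n : nat, match n with O => A w | _ => B w end)).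
  - apply (sa_cunion (fun n w => match n with O => A w | _ => B w end)).
    intros [|n]; assumption.
  - intros w; split.
    + intros [[|n] h]; tauto.
    + intros [h|h]; [exists 0%nat|exists 1%nat]; exact h.
Qed.

Lemma sa_and A B : S A -> S B -> S (fun w => A w /\ B w).
Proof.
  intros hA hB.
  apply (sa_ext S (fun w => ~ (~ A w \/ ~ B w))).
  - apply sa_compl, sa_or; apply sa_compl; assumption.
  - intros w; tauto.
Qed.

Lemma sa_cinter (A : nat -> T -> Prop) : (forall n, S (A n)) -> S (fun w => forall n, A n w).
Proof.
  intros hA.
  apply (sa_ext S (fun w => ~ exists n, ~ A n w)).
  - apply sa_compl, (sa_cunion (fun n w => ~ A n w)); intros n; apply sa_compl, hA.
  - intros w; split.
    + intros h n; apply NNPP; intros h'; apply h; exists n; exact h'.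
    + intros h [n h']; exact (h' (h n)).
Qed.

Lemma sa_list_union {I} (l : list I) (A : I -> T -> Prop) :
  (forall x, S (A x)) -> S (fun w => exists x, In x l /\ A x w).
Proof.
  intros hA; induction l as [|a l IH].
  - apply (sa_ext S (fun _ => False)); [apply sa_const|].
    intros w; split; [tauto|intros [x [[] _]]].
  - apply (sa_ext S (fun w => A a w \/ exists x, In x l /\ A x w)).
    + apply sa_or; [apply hA|exact IH].
    + intros w; split.
      * intros [h|[x [h h']]]; [exists a|exists x]; split; simpl; auto.
      * intros [x [[<-|h] h']]; [left|right; exists x]; auto.
Qed.

Lemma meas_gt f r : measurable S f -> S (fun w => r < f w).
Proof.
  intros hf; apply (sa_ext S (fun w => ~ f w <= r)); [apply sa_compl, hf|].
  intros w; lra.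
Qed.

Lemma inv_INR_S_pos n : 0 < / INR (Datatypes.S n).
Proof. apply Rinv_0_lt_compat, lt_0_INR; lia. Qed.

Lemma meas_lt f r : measurable S f -> S (fun w => f w < r).
Proof.
  intros hf.
  apply (sa_ext S (fun w => exists n : nat, f w <= r - / INR (Datatypes.S n))).
  - apply (sa_cunion (fun n w => f w <= r - / INR (Datatypes.S n))); intros n; apply hf.
  - intros w; split.
    + intros [n h]; pose proof (inv_INR_S_pos n); lra.
    + intros h; destruct (archimed_cor1 (r - f w)) as [n [hn hn0]]; [lra|].
      exists (pred n); replace (Datatypes.S (pred n)) with n by lia; lra.
Qed.

Lemma meas_ge f r : measurable S f -> S (fun w => r <= f w).
Proof.
  intros hf; apply (sa_ext S (fun w => ~ f w < r)); [apply sa_compl, meas_lt, hf|].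
  intros w; lra.
Qed.

Lemma meas_eq f r : measurable S f -> S (fun w => f w = r).
Proof.
  intros hf; apply (sa_ext S (fun w => f w <= r /\ r <= f w)).
  - apply sa_and; [apply hf|apply meas_ge, hf].
  - intros w; lra.
Qed.

Lemma meas_const c : measurable S (fun _ => c).
Proof. intros r; apply sa_const. Qed.

Lemma meas_opp f : measurable S f -> measurable S (fun w => - f w).
Proof.
  intros hf r; apply (sa_ext S (fun w => - r <= f w)); [apply meas_ge, hf|].
  intros w; lra.
Qed.

(** The rationals are written as [(k - j) / (n + 1)] with natural numbers, so that unions over them
    are iterated unions over [nat]. *)
Lemma dense_grid (a b : R) : a < b -> exists n k j : nat,
  a < (INR k - INR j) / INR (Datatypes.S n) < b.
Proof.
  intros h; destruct (archimed_cor1 (b - a)) as [n [hn hn0]]; [lra|].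
  exists (pred n); replace (Datatypes.S (pred n)) with n by lia.
  assert (hp : 0 < INR n) by (apply lt_0_INR; lia).
  set (z := up (a * INR n)).
  assert (hz : INR (Z.to_nat z) - INR (Z.to_nat (- z)) = IZR z).
  { rewrite !INR_IZR_INZ, <- minus_IZR; f_equal; lia. }
  exists (Z.to_nat z), (Z.to_nat (- z)); rewrite hz.
  destruct (archimed (a * INR n)) as [h1 h2]; fold z in h1, h2.
  split.
  - apply (Rmult_lt_reg_r (INR n)); [exact hp|].
    unfold Rdiv; rewrite Rmult_assoc, Rinv_l, Rmult_1_r by lra; exact h1.
  - apply (Rle_lt_trans _ (a + / INR n)); [|lra].
    apply (Rmult_le_reg_r (INR n)); [exact hp|].
    unfold Rdiv; rewrite Rmult_plus_distr_r, Rmult_assoc, !Rinv_l by lra; lra.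
Qed.

(** [r < f + g] holds iff some rational [q] satisfies [q < f] and [r - q < g]. *)
Lemma meas_plus f g :
  measurable S f -> measurable S g -> measurable S (fun w => f w + g w).
Proof.
  intros hf hg r.
  pose (q := fun n k j : nat => (INR k - INR j) / INR (Datatypes.S n)).
  apply (sa_ext S (fun w => ~ exists n k j, q n k j < f w /\ r - q n k j < g w)).
  - apply sa_compl.
    apply (sa_cunion (fun n w => exists k j, q n k j < f w /\ r - q n k j < g w)); intros n.
    apply (sa_cunion (fun k w => exists j, q n k j < f w /\ r - q n k j < g w)); intros k.
    apply (sa_cunion (fun j w => q n k j < f w /\ r - q n k j < g w)); intros j.
    apply sa_and; apply meas_gt; assumption.
  - intros w; split.
    + intros h; apply Rnot_lt_le; intros h'; apply h.
      destruct (dense_grid (r - g w) (f w)) as (n & k & j & h1); [lra|].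
      exists n, k, j; unfold q; lra.
    + intros h (n & k & j & h1); lra.
Qed.

Lemma meas_sum (f : nat -> T -> R) n : (forall i, (i <= n)%nat -> measurable S (f i)) ->
  measurable S (fun w => sum_f_R0 (fun i => f i w) n).
Proof.
  induction n as [|n IH]; intros hf; simpl.
  - apply hf; lia.
  - apply meas_plus; [apply IH; intros i hi|]; apply hf; lia.
Qed.

(** The decision [d] is a parameter, so that the lemma serves both [indic] and tests such as
    [Rle_dec]. *)
Lemma meas_if A f g (d : forall w, {A w} + {~ A w}) : S A -> measurable S f -> measurable S g ->
  measurable S (fun w => if d w then f w else g w).
Proof.
  intros hA hf hg r.
  apply (sa_ext S (fun w => (A w /\ f w <= r) \/ (~ A w /\ g w <= r))).
  - apply sa_or; apply sa_and; auto using sa_compl.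
  - intros w; destruct (d w); tauto.
Qed.

Lemma meas_indic A : S A -> measurable S (indic A).
Proof.
  intros hA; unfold indic.
  apply (meas_if A (fun _ => 1) (fun _ => 0)); auto using meas_const.
Qed.

Lemma meas_abs f : measurable S f -> measurable S (fun w => Rabs (f w)).
Proof.
  intros hf r; apply (sa_ext S (fun w => f w <= r /\ - r <= f w)).
  - apply sa_and; [apply hf|apply meas_ge, hf].
  - intros w; split; [intros h; apply Rabs_le; lra|].
    intros h; pose proof (Rle_abs (f w)); pose proof (Rle_abs (- f w)).
    rewrite Rabs_Ropp in *; lra.
Qed.

Lemma meas_max0 f : measurable S f -> measurable S (fun w => Rmax (f w) 0).
Proof.
  intros hf r; apply (sa_ext S (fun w => f w <= r /\ 0 <= r)).
  - apply sa_and; [apply hf|apply sa_const].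
  - intros w; unfold Rmax; destruct (Rle_dec (f w) 0); lra.
Qed.

(** Good-sets argument: the sets whose preimage lies in [S] form a sigma-algebra containing the
    half-lines. *)
Lemma meas_preimage f B : measurable S f -> borel B -> S (fun w => B (f w)).
Proof.
  intros hf hB.
  apply (hB (fun B => S (fun w => B (f w)))).
  - split; [|split].
    + apply sa_const.
    + intros A hA; apply sa_compl, hA.
    + intros A hA; apply (sa_cunion (fun n w => A n (f w))), hA.
  - intros C [a ->]; apply hf.
Qed.

Lemma meas_comp h f : borel_fun h -> measurable S f -> measurable S (fun w => h (f w)).
Proof.
  intros hh hf r; exact (meas_preimage f (fun x => h x <= r) hf (hh r)).
Qed.

End SigmaAlgebra.

Lemma meas_mono {T} (S S' : (T -> Prop) -> Prop) f :
  (forall A, S A -> S' A) -> measurable S f -> measurable S' f.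
Proof. intros h hf r; apply h, hf. Qed.

(** * Borel sets of the line and the plane; indicators *)

Lemma borel_sa : is_sigma_algebra borel.
Proof. apply sigma_gen_sa. Qed.

Lemma borel_id : borel_fun (fun x => x).
Proof. intros r; apply sigma_gen_base; exists r; reflexivity. Qed.

Lemma borel2_sa : is_sigma_algebra borel2.
Proof. apply sigma_gen_sa. Qed.

(** A half-plane is a countable union of quadrants, cut at [INR n] in the other coordinate. *)
Lemma borel2_fst : measurable borel2 fst.
Proof.
  intros a; apply (sa_ext borel2 (fun p : R * R => exists n : nat, fst p <= a /\ snd p <= INR n)).
  - apply (sa_cunion borel2_sa (fun n (p : R * R) => fst p <= a /\ snd p <= INR n)).
    intros n; apply sigma_gen_base; exists a, (INR n); reflexivity.
  - intros [x y]; simpl; split; [intros [n h]; tauto|].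
    intros h; destruct (INR_unbounded y) as [n hn]; exists n; lra.
Qed.

Lemma borel2_snd : measurable borel2 snd.
Proof.
  intros a; apply (sa_ext borel2 (fun p : R * R => exists n : nat, fst p <= INR n /\ snd p <= a)).
  - apply (sa_cunion borel2_sa (fun n (p : R * R) => fst p <= INR n /\ snd p <= a)).
    intros n; apply sigma_gen_base; exists (INR n), a; reflexivity.
  - intros [x y]; simpl; split; [intros [n h]; tauto|].
    intros h; destruct (INR_unbounded x) as [n hn]; exists n; lra.
Qed.

Lemma indic_1 {T} (A : T -> Prop) w : A w -> indic A w = 1.
Proof. intros h; unfold indic; destruct (excluded_middle_informative (A w)); tauto. Qed.

Lemma indic_0 {T} (A : T -> Prop) w : ~ A w -> indic A w = 0.
Proof. intros h; unfold indic; destruct (excluded_middle_informative (A w)); tauto. Qed.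

Lemma indic_cases {T} (A : T -> Prop) w :
  (A w /\ indic A w = 1) \/ (~ A w /\ indic A w = 0).
Proof. unfold indic; destruct (excluded_middle_informative (A w)); tauto. Qed.

(** * Sublinear expectations *)

(** The upper bound for the averages uses the expectation at time 0 only through these
    properties. *)
Record upper_exp {Om : Type} (F : (Om -> Prop) -> Prop) (H : (Om -> R) -> Prop)
  (e : (Om -> R) -> R) : Prop := {
  ue_sa : is_sigma_algebra F;
  ue_space : is_space F H;
  ue_mono : forall X Y, H X -> H Y -> (forall w, X w <= Y w) -> e X <= e Y;
  ue_sub : forall X Y, H X -> H Y -> e (fun w => X w + Y w) <= e X + e Y;
  ue_hom : forall a X, 0 <= a -> H X -> e (fun w => a * X w) = a * e X;
  ue_const : forall c, e (fun _ => c) = c;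
  ue_cont : forall Xs : nat -> Om -> R, (forall i, H (Xs i)) ->
    (forall i w, Xs (S i) w <= Xs i w) -> (forall w, Un_cv (fun i => Xs i w) 0) ->
    Un_cv (fun i => e (Xs i)) 0 }.

Section UpperExpectation.
Context {Om : Type} {F : (Om -> Prop) -> Prop} {H : (Om -> R) -> Prop}
  {e : (Om -> R) -> R} (U : upper_exp F H e).

Let Fsa : is_sigma_algebra F := ue_sa _ _ _ U.

Lemma H_meas X : H X -> measurable F X.
Proof. apply (ue_space _ _ _ U). Qed.

Lemma H_const c : H (fun _ => c).
Proof. apply (ue_space _ _ _ U). Qed.

Lemma H_plus X Y : H X -> H Y -> H (fun w => X w + Y w).
Proof. apply (ue_space _ _ _ U). Qed.

Lemma H_scal a X : H X -> H (fun w => a * X w).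
Proof. apply (ue_space _ _ _ U). Qed.

Lemma H_abs X : H X -> H (fun w => Rabs (X w)).
Proof. apply (ue_space _ _ _ U). Qed.

Lemma H_indmul A X : F A -> H X -> H (fun w => indic A w * X w).
Proof. apply (ue_space _ _ _ U). Qed.

Lemma H_ext X Y : H X -> (forall w, X w = Y w) -> H Y.
Proof. intros hX h; replace Y with X; [exact hX|apply functional_extensionality, h]. Qed.

Lemma e_ext X Y : (forall w, X w = Y w) -> e X = e Y.
Proof. intros h; f_equal; apply functional_extensionality, h. Qed.

Lemma H_indic A : F A -> H (indic A).
Proof.
  intros hA; apply (H_ext (fun w => indic A w * 1)); [|intros w; ring].
  apply H_indmul; [exact hA|apply H_const].
Qed.

Lemma H_opp X : H X -> H (fun w => - X w).
Proof. intros hX; apply (H_ext (fun w => -1 * X w)); [apply H_scal, hX|intros w; ring]. Qed.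

Lemma H_minus X Y : H X -> H Y -> H (fun w => X w - Y w).
Proof. intros hX hY; apply H_plus; [exact hX|apply H_opp, hY]. Qed.

Lemma H_max0 X : H X -> H (fun w => Rmax (X w) 0).
Proof.
  intros hX; apply (H_ext (fun w => /2 * (X w + Rabs (X w)))).
  - apply H_scal, H_plus; [|apply H_abs]; exact hX.
  - intros w; unfold Rmax, Rabs; destruct (Rle_dec (X w) 0), (Rcase_abs (X w)); lra.
Qed.

Lemma H_sum (X : nat -> Om -> R) n : (forall i, H (X i)) ->
  H (fun w => sum_f_R0 (fun i => X i w) n).
Proof.
  intros hX; induction n as [|n IH]; simpl; [apply hX|].
  apply H_plus; [exact IH|apply hX].
Qed.

Lemma e_nonneg X : H X -> (forall w, 0 <= X w) -> 0 <= e X.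
Proof.
  intros hX h; rewrite <- (ue_const _ _ _ U 0).
  apply (ue_mono _ _ _ U); [apply H_const|exact hX|exact h].
Qed.

(** Subadditivity gives one inequality directly and the other from [X = (X + c) + (- c)]. *)
Lemma e_translate X c : H X -> e (fun w => X w + c) = e X + c.
Proof.
  intros hX; pose proof (H_const c) as hc; pose proof (H_const (- c)) as hc'.
  apply Rle_antisym.
  - pose proof (ue_sub _ _ _ U X (fun _ => c) hX hc) as h.
    rewrite (ue_const _ _ _ U) in h; exact h.
  - pose proof (ue_sub _ _ _ U (fun w => X w + c) (fun _ => - c) (H_plus _ _ hX hc) hc') as h.
    rewrite (e_ext _ X), (ue_const _ _ _ U) in h by (intros w; ring); lra.
Qed.

Lemma e_sum_le (X : nat -> Om -> R) n : (forall i, H (X i)) ->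
  e (fun w => sum_f_R0 (fun i => X i w) n) <= sum_f_R0 (fun i => e (X i)) n.
Proof.
  intros hX; induction n as [|n IH]; simpl; [apply Rle_refl|].
  eapply Rle_trans; [apply (ue_sub _ _ _ U _ (X (S n)))|apply Rplus_le_compat_r, IH].
  - apply H_sum, hX.
  - apply hX.
Qed.

Lemma e_opp_nonneg X : H X -> 0 <= e X + e (fun w => - X w).
Proof.
  intros hX; pose proof (ue_sub _ _ _ U X _ hX (H_opp X hX)) as h.
  rewrite (e_ext _ (fun _ => 0)), (ue_const _ _ _ U) in h by (intros w; ring); exact h.
Qed.

Lemma e_cont (Xs : nat -> Om -> R) (eps : R) : (forall i, H (Xs i)) ->
  (forall i w, Xs (S i) w <= Xs i w) -> (forall w, Un_cv (fun i => Xs i w) 0) ->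
  0 < eps -> exists N, forall n, (n >= N)%nat -> e (Xs n) < eps.
Proof.
  intros h1 h2 h3 he; destruct (ue_cont _ _ _ U Xs h1 h2 h3 eps he) as [N hN].
  exists N; intros n hn; specialize (hN n hn); unfold Rdist in hN.
  rewrite Rminus_0_r in hN; apply Rle_lt_trans with (2 := hN), Rle_abs.
Qed.

(** * Capacities of events *)

Lemma V_mono A B : F A -> F B -> (forall w, A w -> B w) -> e (indic A) <= e (indic B).
Proof.
  intros hA hB h; apply (ue_mono _ _ _ U); auto using H_indic.
  intros w; pose proof (h w).
  destruct (indic_cases A w) as [[? ->]|[? ->]], (indic_cases B w) as [[? ->]|[? ->]]; tauto || lra.
Qed.

Lemma V_nonneg A : F A -> 0 <= e (indic A).
Proof.
  intros hA; apply e_nonneg; [apply H_indic, hA|].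
  intros w; destruct (indic_cases A w) as [[_ ->]|[_ ->]]; lra.
Qed.

Lemma V_or A B C : F A -> F B -> F C -> (forall w, A w -> B w \/ C w) ->
  e (indic A) <= e (indic B) + e (indic C).
Proof.
  intros hA hB hC h; eapply Rle_trans; [|apply (ue_sub _ _ _ U); auto using H_indic].
  apply (ue_mono _ _ _ U); auto using H_indic, H_plus.
  intros w; pose proof (h w).
  destruct (indic_cases A w) as [[? ->]|[? ->]], (indic_cases B w) as [[? ->]|[? ->]],
    (indic_cases C w) as [[? ->]|[? ->]]; tauto || lra.
Qed.

Lemma V_down (A : nat -> Om -> Prop) eps : (forall n, F (A n)) ->
  (forall n w, A (S n) w -> A n w) -> (forall w, exists n, ~ A n w) -> 0 < eps ->
  exists N, forall n, (n >= N)%nat -> e (indic (A n)) < eps.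
Proof.
  intros hA hd h0; apply (e_cont (fun n => indic (A n))).
  - intros n; apply H_indic, hA.
  - intros n w; pose proof (hd n w).
    destruct (indic_cases (A n) w) as [[? ->]|[? ->]],
      (indic_cases (A (S n)) w) as [[? ->]|[? ->]]; tauto || lra.
  - intros w d hd0; destruct (h0 w) as [n hn]; exists n; intros k hk.
    rewrite indic_0; [unfold Rdist; rewrite Rminus_0_r, Rabs_R0; exact hd0|].
    induction hk; auto.
Qed.

(** The part of the union outside [A n] decreases to the empty set, so [V_down] makes its capacity
    small. *)
Lemma V_up (A : nat -> Om -> Prop) M : (forall n, F (A n)) ->
  (forall n w, A n w -> A (S n) w) -> (forall n, e (indic (A n)) <= M) ->
  e (indic (fun w => exists n, A n w)) <= M.
Proof.
  intros hA hi hM; apply Rle_plus_epsilon; intros eps he.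
  assert (hU : F (fun w => exists n, A n w)) by (apply (sa_cunion Fsa), hA).
  assert (hD : forall n, F (fun w => (exists k, A k w) /\ ~ A n w)).
  { intros n; apply (sa_and Fsa); [exact hU|apply (sa_compl Fsa), hA]. }
  destruct (V_down (fun n w => (exists k, A k w) /\ ~ A n w) eps hD) as [N hN]; [| |exact he|].
  - intros n w; pose proof (hi n w); tauto.
  - intros w; destruct (classic (exists k, A k w)) as [[k hk]|hk]; [exists k|exists 0%nat]; tauto.
  - specialize (hN N (le_n _)); specialize (hM N).
    assert (h := V_or _ _ _ hU (hA N) (hD N)).
    enough (e (indic (fun w => exists n, A n w)) <=
      e (indic (A N)) + e (indic (fun w => (exists k, A k w) /\ ~ A N w))) by lra.
    apply h; intros w hw; destruct (classic (A N w)); tauto.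
Qed.

(** Finite unions are bounded by the partial sums, and [V_up] passes to the limit. *)
Lemma V_cunion (A : nat -> Om -> Prop) M : (forall n, F (A n)) ->
  (forall n, sum_f_R0 (fun i => e (indic (A i))) n <= M) ->
  e (indic (fun w => exists n, A n w)) <= M.
Proof.
  intros hA hM.
  pose (B := fun n w => exists i, (i <= n)%nat /\ A i w).
  assert (hB : forall n, F (B n)).
  { intros n; apply (sa_ext F (fun w => exists i, In i (seq 0 (S n)) /\ A i w)).
    - apply (sa_list_union Fsa), hA.
    - intros w; split; intros [i [h h']]; exists i; split; auto; apply in_seq in h || apply in_seq; lia. }
  assert (hBM : forall n, e (indic (B n)) <= sum_f_R0 (fun i => e (indic (A i))) n).
  { induction n as [|n IH]; simpl.
    - apply V_mono; auto; intros w [i [h h']]; replace i with 0%nat in h' by lia; exact h'.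
    - eapply Rle_trans; [apply (V_or (B (S n)) (B n) (A (S n))); auto|lra].
      intros w [i [h h']]; destruct (Nat.eq_dec i (S n)) as [->|hi]; [right; exact h'|].
      left; exists i; split; [lia|exact h']. }
  rewrite (set_ext (fun w => exists n, A n w) (fun w => exists n, B n w)).
  - apply V_up; auto.
    + intros n w [i [h h']]; exists i; split; [lia|exact h'].
    + intros n; eapply Rle_trans; [apply hBM|apply hM].
  - intros w; split; [intros [n h]; exists n, n; auto|].
    intros [n [i [_ h]]]; exists i; exact h.
Qed.

Lemma null_cunion (A : nat -> Om -> Prop) : (forall n, F (A n)) ->
  (forall n, e (indic (A n)) = 0) -> e (indic (fun w => exists n, A n w)) = 0.
Proof.
  intros hA h0; apply Rle_antisym; [|apply V_nonneg, (sa_cunion Fsa), hA].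
  apply V_cunion; [exact hA|].
  induction n as [|n IH]; simpl; rewrite h0; lra.
Qed.

(** The excesses decrease to 0 pointwise, so continuity of [e] applies: a single element of [H] is
    uniformly integrable from above. *)
Lemma e_excess (X : Om -> R) eps : H X -> 0 < eps ->
  exists N : nat, forall n, (n >= N)%nat -> e (fun w => Rmax (X w - INR n) 0) < eps.
Proof.
  intros hX; apply (e_cont (fun n w => Rmax (X w - INR n) 0)).
  - intros n; apply H_max0, H_minus; [exact hX|apply H_const].
  - intros n w; rewrite S_INR; apply Rmax_case; [|apply Rmax_r].
    eapply Rle_trans; [|apply Rmax_l]; lra.
  - intros w d hd; destruct (INR_unbounded (X w)) as [n hn]; exists n; intros k hk.
    apply le_INR in hk; rewrite Rmax_right by lra.
    unfold Rdist; rewrite Rminus_0_r, Rabs_R0; exact hd.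
Qed.

Lemma e_tail (X : Om -> R) eps : H X -> 0 < eps ->
  exists N : nat, forall n, (n >= N)%nat ->
    e (fun w => indic (fun w' => INR n < Rabs (X w')) w * Rabs (X w)) < eps.
Proof.
  intros hX.
  assert (hF : forall n, F (fun w => INR n < Rabs (X w))).
  { intros n; apply (meas_gt Fsa), H_meas, H_abs, hX. }
  apply (e_cont (fun n w => indic (fun w' => INR n < Rabs (X w')) w * Rabs (X w))).
  - intros n; apply H_indmul; [apply hF|apply H_abs, hX].
  - intros n w; pose proof (Rabs_pos (X w)); rewrite S_INR.
    destruct (indic_cases (fun w' => INR n < Rabs (X w')) w) as [[? ->]|[? ->]],
      (indic_cases (fun w' => INR n + 1 < Rabs (X w')) w) as [[? ->]|[? ->]]; lra.
  - intros w d hd; destruct (INR_unbounded (Rabs (X w))) as [n hn]; exists n; intros k hk.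
    apply le_INR in hk; rewrite indic_0 by lra.
    rewrite Rmult_0_l; unfold Rdist; rewrite Rminus_0_r, Rabs_R0; exact hd.
Qed.

(** [X] may be unbounded, so it is cut at height [n]: [I_N X <= n I_N + (X - n)^+], where the first
    term has expectation 0 and the second a small one. *)
Lemma e_null (N : Om -> Prop) X : F N -> e (indic N) = 0 -> H X ->
  e (fun w => indic N w * X w) <= 0.
Proof.
  intros hN h0 hX; apply Rle_plus_epsilon; intros eps he.
  destruct (e_excess X eps hX he) as [n hn]; specialize (hn n (le_n _)).
  assert (hE : H (fun w => Rmax (X w - INR n) 0)).
  { apply H_max0, H_minus; [exact hX|apply H_const]. }
  assert (hI : H (fun w => INR n * indic N w)) by (apply H_scal, H_indic, hN).
  assert (h : e (fun w => indic N w * X w)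
    <= e (fun w => INR n * indic N w + Rmax (X w - INR n) 0)).
  { apply (ue_mono _ _ _ U); [apply H_indmul; assumption|apply H_plus; assumption|].
    intros w; pose proof (Rmax_l (X w - INR n) 0); pose proof (Rmax_r (X w - INR n) 0).
    destruct (indic_cases N w) as [[_ ->]|[_ ->]]; lra. }
  pose proof (ue_sub _ _ _ U _ _ hI hE) as h1; simpl in h1.
  rewrite (ue_hom _ _ _ U), h0, Rmult_0_r in h1 by auto using pos_INR, H_indic; lra.
Qed.

Lemma e_markov (X : Om -> R) c : H X -> 0 < c -> (forall w, 0 <= X w) ->
  e (indic (fun w => c < X w)) <= e X / c.
Proof.
  intros hX hc h; apply (Rmult_le_reg_l c); [exact hc|].
  replace (c * (e X / c)) with (e X) by (field; lra).
  assert (hI : H (indic (fun w => c < X w))) by (apply H_indic, (meas_gt Fsa), H_meas, hX).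
  rewrite <- (ue_hom _ _ _ U) by (lra || exact hI).
  apply (ue_mono _ _ _ U); [apply H_scal, hI|exact hX|].
  intros w; pose proof (h w).
  destruct (indic_cases (fun w => c < X w) w) as [[? ->]|[? ->]]; lra.
Qed.

(** * Quasi-sure properties *)

Definition quasi_surely (P : Om -> Prop) : Prop :=
  exists N, F N /\ e (indic N) = 0 /\ forall w, ~ N w -> P w.

(** One null set is chosen for each [j]; their countable union is again null. *)
Lemma quasi_surely_all (P : nat -> Om -> Prop) : (forall j, quasi_surely (P j)) ->
  quasi_surely (fun w => forall j, P j w).
Proof.
  intros h; pose (N := fun j => proj1_sig (constructive_indefinite_description _ (h j))).
  assert (hN : forall j, F (N j) /\ e (indic (N j)) = 0 /\ forall w, ~ N j w -> P j w).
  { intros j; exact (proj2_sig (constructive_indefinite_description _ (h j))). }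
  exists (fun w => exists j, N j w); split; [|split].
  - apply (sa_cunion Fsa); intros j; apply hN.
  - apply null_cunion; intros j; apply hN.
  - intros w hw j; apply hN; intros hj; apply hw; exists j; exact hj.
Qed.

(** Conjunction and weakening in one step; with [P = Q] it is plain monotonicity. *)
Lemma quasi_surely_and (P Q R : Om -> Prop) : (forall w, P w -> Q w -> R w) ->
  quasi_surely P -> quasi_surely Q -> quasi_surely R.
Proof.
  intros hR hP hQ.
  destruct (quasi_surely_all (fun j => match j with O => P | _ => Q end)) as (N & hN & hN0 & h).
  - intros [|j]; assumption.
  - exists N; split; [exact hN|split; [exact hN0|]].
    intros w hw; exact (hR w (h w hw 0%nat) (h w hw 1%nat)).
Qed.

(** If no point satisfied [P], the exceptional set would be the whole space, of capacity 1. *)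
Lemma quasi_surely_witness P : quasi_surely P -> exists w, P w.
Proof.
  intros (N & _ & hN & h); apply NNPP; intros h'.
  rewrite (e_ext (indic N) (fun _ => 1)), (ue_const _ _ _ U) in hN; [lra|].
  intros w; apply indic_1, NNPP; intros hw; apply h'; exists w; exact (h w hw).
Qed.

(** Membership in [H] travels with the bound, so that a long majorant can be estimated summand by
    summand. *)
Lemma e_plus_le X Y x y : H X /\ e X <= x -> H Y /\ e Y <= y ->
  H (fun w => X w + Y w) /\ e (fun w => X w + Y w) <= x + y.
Proof.
  intros [hX hx] [hY hy]; split; [apply H_plus; assumption|].
  pose proof (ue_sub _ _ _ U X Y hX hY); lra.
Qed.

Lemma e_scal_le c X x : 0 <= c -> H X /\ e X <= x ->
  H (fun w => c * X w) /\ e (fun w => c * X w) <= c * x.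
Proof.
  intros hc [hX hx]; split; [apply H_scal, hX|].
  rewrite (ue_hom _ _ _ U) by assumption; apply Rmult_le_compat_l; assumption.
Qed.

End UpperExpectation.

Arguments quasi_surely {Om} F e P.

(** * Finite-valued functions *)

(* [H] is not closed under products; finite-valued measurable functions belong to [H], and they are closed under all pointwise operations. *)
Definition simple {T : Type} (S : (T -> Prop) -> Prop) (f : T -> R) : Prop :=
  measurable S f /\ exists l : list R, forall w, In (f w) l.

Lemma simple_const {T} (S : (T -> Prop) -> Prop) c : is_sigma_algebra S -> simple S (fun _ => c).
Proof.
  intros HS; split; [apply (meas_const HS)|exists (c :: nil); intros w; left; reflexivity].
Qed.

Lemma simple_mono {T} (S S' : (T -> Prop) -> Prop) f :
  (forall A, S A -> S' A) -> simple S f -> simple S' f.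
Proof. intros h [hm hl]; split; [exact (meas_mono S S' f h hm)|exact hl]. Qed.

(** A sublevel set is a finite union over pairs of values of [f1] and [f2], so [g] can be an
    arbitrary function. *)
Lemma simple_comp2 {T} (S : (T -> Prop) -> Prop) (g : R -> R -> R) f1 f2 :
  is_sigma_algebra S -> simple S f1 -> simple S f2 -> simple S (fun w => g (f1 w) (f2 w)).
Proof.
  intros HS [m1 [l1 h1]] [m2 [l2 h2]]; split.
  - intros r.
    apply (sa_ext S (fun w => exists p, In p (list_prod l1 l2) /\
      ((f1 w = fst p /\ f2 w = snd p) /\ g (fst p) (snd p) <= r))).
    + apply (sa_list_union HS); intros p.
      apply (sa_and HS (fun w => f1 w = fst p /\ f2 w = snd p)); [|apply (sa_const HS)].
      apply (sa_and HS (fun w => f1 w = fst p)); apply (meas_eq HS); assumption.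
    + intros w; split; [intros [p [_ [[-> ->] h]]]; exact h|].
      intros h; exists (f1 w, f2 w); repeat split; auto using in_prod.
  - exists (map (fun p => g (fst p) (snd p)) (list_prod l1 l2)); intros w.
    apply (in_map (fun p => g (fst p) (snd p)) _ (f1 w, f2 w)), in_prod; auto.
Qed.

Lemma simple_comp {T} (S : (T -> Prop) -> Prop) (g : R -> R) f :
  is_sigma_algebra S -> simple S f -> simple S (fun w => g (f w)).
Proof. intros HS hf; exact (simple_comp2 S (fun x _ => g x) f f HS hf hf). Qed.

(** The values of [L] are peeled off one at a time. The coefficient [c] is an attained value of [L],
    so a sign condition on [L] passes to the coefficients. *)
Lemma simple_ind {T} (S : (T -> Prop) -> Prop) (P : (T -> R) -> Prop) L :
  is_sigma_algebra S -> P (fun _ => 0) ->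
  (forall c A f, (exists w, L w = c) -> S A -> P f -> P (fun w => c * indic A w + f w)) ->
  simple S L -> P L.
Proof.
  intros HS h0 hP [hm [l hl]].
  assert (h : forall l, P (fun w => if in_dec Req_dec_T (L w) l then L w else 0)).
  { clear l hl; induction l as [|a l IH]; [exact h0|].
    (* A value that is already listed, or never attained, leaves the restriction of [L] unchanged;
       otherwise the new term is [a] times the indicator of [{L = a}]. *)
    destruct (classic (In a l \/ ~ exists w, L w = a)) as [ha|ha].
    - match goal with |- P ?f => replace f with
        (fun w => if in_dec Req_dec_T (L w) l then L w else 0); [exact IH|] end.
      apply functional_extensionality; intros w.
      destruct (in_dec Req_dec_T (L w) l) as [i|i],
        (in_dec Req_dec_T (L w) (a :: l)) as [[->|j]|j]; auto; try tauto.
      + destruct j; right; exact i.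
      + destruct ha as [ha|ha]; [tauto|destruct ha; exists w; reflexivity].
    - apply not_or_and in ha; destruct ha as [ha ha']; apply NNPP in ha'.
      specialize (hP a (fun w => L w = a) _ ha' (meas_eq HS L a hm) IH).
      match goal with |- P ?f => match type of hP with P ?g => replace f with g; [exact hP|] end end.
      apply functional_extensionality; intros w.
      destruct (indic_cases (fun w => L w = a) w) as [[hw ->]|[hw ->]],
        (in_dec Req_dec_T (L w) l) as [i|i],
        (in_dec Req_dec_T (L w) (a :: l)) as [j|j]; try lra.
      + rewrite hw in i; tauto.
      + rewrite hw in i; tauto.
      + destruct j; left; auto.
      + destruct j; right; auto.
      + destruct j as [j|j]; [destruct hw; auto|tauto]. }
  specialize (h l); replace L with (fun w => if in_dec Req_dec_T (L w) l then L w else 0);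
    [exact h|].
  apply functional_extensionality; intros w; destruct (in_dec _ _ _); [reflexivity|].
  destruct n; apply hl.
Qed.

Section SimpleExpectation.
Context {Om : Type} {F : (Om -> Prop) -> Prop} {H : (Om -> R) -> Prop}
  {e : (Om -> R) -> R} (U : upper_exp F H e).

Lemma H_simple f : simple F f -> H f.
Proof.
  apply simple_ind; [apply (ue_sa _ _ _ U)|apply (H_const U)|].
  intros c A g _ hA hg; apply (H_plus U); [apply (H_scal U), (H_indic U), hA|exact hg].
Qed.

(** [L] is a combination of indicators of sets in [S] with nonnegative coefficients, so
    subadditivity and positive homogeneity suffice. *)
Lemma e_simple_mul_nonpos S L Z : is_sigma_algebra S -> (forall A, S A -> F A) ->
  simple S L -> (forall w, 0 <= L w) -> H Z ->
  (forall A, S A -> e (fun w => indic A w * Z w) <= 0) ->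
  H (fun w => L w * Z w) /\ e (fun w => L w * Z w) <= 0.
Proof.
  intros HS hSF hL hp hZ hZA.
  apply (simple_ind S (fun f => H (fun w => f w * Z w) /\ e (fun w => f w * Z w) <= 0)
    L HS); [| |exact hL].
  - rewrite (e_ext (e := e) _ (fun _ => 0)), (ue_const _ _ _ U) by (intros w; ring).
    split; [|lra].
    apply (H_ext (fun _ => 0)); [apply (H_const U)|intros w; ring].
  - intros c A f [w0 hc] hA [hf hf'].
    assert (hc0 : 0 <= c) by (rewrite <- hc; apply hp).
    assert (hAZ : H (fun w => indic A w * Z w)) by (apply (H_indmul U); auto).
    assert (hcAZ : H (fun w => c * (indic A w * Z w))) by (apply (H_scal U), hAZ).
    split.
    + apply (H_ext (fun w => c * (indic A w * Z w) + f w * Z w)); [|intros w; ring].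
      apply (H_plus U); assumption.
    + rewrite (e_ext (e := e) _ (fun w => c * (indic A w * Z w) + f w * Z w)) by (intros w; ring).
      eapply Rle_trans; [apply (ue_sub _ _ _ U); assumption|].
      rewrite (ue_hom _ _ _ U) by assumption.
      specialize (hZA A hA); nra.
Qed.

End SimpleExpectation.

(** * Real series *)

(** A tail is encoded by zeroing the terms before [m], the form in which sequences are later
    restarted at time [m]. The threshold [m0] is one past an index where the partial sum is within
    [eta] of the supremum. *)
Lemma sum_tail_small (t : nat -> R) B eta : (forall i, 0 <= t i) ->
  (forall n, sum_f_R0 t n <= B) -> 0 < eta ->
  exists m0, forall m n, (m0 <= m)%nat ->
    sum_f_R0 (fun i => if lt_dec i m then 0 else t i) n <= eta.
Proof.
  intros ht hB heta.
  destruct (completeness (fun x => exists n, x = sum_f_R0 t n)) as [L [hL1 hL2]].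
  - exists B; intros x [n ->]; apply hB.
  - exists (t 0%nat), 0%nat; reflexivity.
  - assert (hn : exists n, L - eta < sum_f_R0 t n).
    { apply NNPP; intros h; assert (hc : L <= L - eta); [|lra].
      apply hL2; intros x [n ->]; apply Rnot_lt_le; intros h'; apply h; exists n; exact h'. }
    destruct hn as [n0 hn0]; exists (S n0); intros m n hm.
    pose (u := fun n => sum_f_R0 (fun i => if lt_dec i m then 0 else t i) n); fold (u n).
    assert (h : ((n <= n0)%nat -> u n = 0) /\
      ((n0 <= n)%nat -> u n + sum_f_R0 t n0 <= sum_f_R0 t n)).
    { induction n as [|n [IH1 IH2]].
      - unfold u; simpl; destruct (lt_dec 0 m); [|lia]; split; [auto|].
        intros h; replace n0 with 0%nat by lia; simpl; lra.
      - unfold u in *; simpl; split; intros h.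
        + rewrite IH1 by lia; destruct (lt_dec (S n) m); [lra|lia].
        + destruct (Nat.eq_dec n0 (S n)) as [->|hne].
          * rewrite IH1 by lia; destruct (lt_dec (S n) m); [simpl; lra|lia].
          * specialize (IH2 ltac:(lia)); specialize (ht (S n)).
            destruct (lt_dec (S n) m); lra. }
    destruct (le_dec n n0) as [hle|hle].
    + destruct h as [h _]; rewrite h by assumption; lra.
    + destruct h as [_ h]; specialize (h ltac:(lia)).
      specialize (hL1 _ (ex_intro _ n eq_refl)); lra.
Qed.

(** Telescoping: [1 / (x + 1)^2 <= 1 / x - 1 / (x + 1)]. *)
Lemma sum_inv_sqr_le n : sum_f_R0 (fun i => / INR (S i) ^ 2) n <= 2 - / INR (S n).
Proof.
  induction n as [|n IH]; [simpl; lra|].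
  rewrite tech5; rewrite (S_INR (S n)).
  set (x := INR (S n)) in *; assert (hx : 0 < x) by (apply lt_0_INR; lia).
  enough (/ (x + 1) ^ 2 <= / x - / (x + 1)) by lra.
  replace (/ x - / (x + 1)) with (/ (x * (x + 1))) by (field; lra).
  apply Rinv_le_contravar; nra.
Qed.

(* The second term on the left makes the induction go through. *)
Lemma sum_weighted_avg_le (a : nat -> R) n : (forall i, 0 <= a i) ->
  let q := fun i => sum_f_R0 (fun m => INR (S m) * a m) i in
  sum_f_R0 (fun i => q i / INR (S i) ^ 2) n + q n / INR (S n) <= 2 * sum_f_R0 a n.
Proof.
  intros ha q; induction n as [|n IH].
  - unfold q; simpl; lra.
  - rewrite !tech5.
    assert (hq : q (S n) = q n + INR (S (S n)) * a (S n)) by (unfold q; apply tech5).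
    assert (hq0 : 0 <= q n).
    { unfold q; apply cond_pos_sum; intros k; apply Rmult_le_pos; [apply pos_INR|apply ha]. }
    rewrite hq, (S_INR (S n)); specialize (ha (S n)).
    set (x := INR (S n)) in *; assert (hx : 1 <= x).
    { unfold x; rewrite S_INR; pose proof (pos_INR n); lra. }
    (* The new terms are regrouped: the coefficient of [q n] is at most [1 / x], which the induction
       hypothesis pays for, and that of [a (S n)] is at most 2. *)
    assert (h1 : (q n + (x + 1) * a (S n)) / (x + 1) ^ 2 + (q n + (x + 1) * a (S n)) / (x + 1)
      = q n * ((x + 2) / (x + 1) ^ 2) + a (S n) * (/ (x + 1) + 1)) by (field; lra).
    assert (h2 : (x + 2) / (x + 1) ^ 2 <= / x).
    { apply (Rmult_le_reg_r ((x + 1) ^ 2 * x)); [nra|].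
      replace ((x + 2) / (x + 1) ^ 2 * ((x + 1) ^ 2 * x)) with ((x + 2) * x) by (field; lra).
      replace (/ x * ((x + 1) ^ 2 * x)) with ((x + 1) ^ 2) by (field; lra); nra. }
    assert (h3 : / (x + 1) <= 1).
    { rewrite <- Rinv_1; apply Rinv_le_contravar; lra. }
    unfold Rdiv at 2 in IH; nra.
Qed.

(** The indices up to [i1] cost at most the constant [M], which is below [eta (n + 1)] once [n]
    exceeds [M / eta]. *)
Lemma average_eventually_le (x z : nat -> R) c lam i1 eta : 0 < eta ->
  (forall i, (i1 <= i)%nat -> x i <= z i + c) ->
  (forall n, sum_f_R0 z n <= lam * INR (S n)) ->
  exists N, forall n, (N <= n)%nat -> sum_f_R0 x n / INR (S n) <= lam + c + eta.
Proof.
  intros heta h1 h2.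
  pose (M := sum_f_R0 (fun i => Rabs (x i - z i - c)) i1).
  assert (hM : forall n, sum_f_R0 x n <= sum_f_R0 z n + c * INR (S n) + M).
  { intros n.
    assert (h : sum_f_R0 x n <= sum_f_R0 z n + c * INR (S n)
      + sum_f_R0 (fun i => Rabs (x i - z i - c)) (Nat.min n i1)).
    { induction n as [|n IH].
      - simpl; pose proof (Rle_abs (x 0%nat - z 0%nat - c)); lra.
      - rewrite !tech5, (S_INR (S n)); destruct (le_dec (S n) i1) as [hl|hl].
        + rewrite Nat.min_l in * by lia; rewrite tech5.
          pose proof (Rle_abs (x (S n) - z (S n) - c)); lra.
        + rewrite Nat.min_r in * by lia; specialize (h1 (S n) ltac:(lia)); lra. }
    eapply Rle_trans; [exact h|]; apply Rplus_le_compat_l; unfold M.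
    assert (hmono : forall k l, (k <= l)%nat -> sum_f_R0 (fun i => Rabs (x i - z i - c)) k
      <= sum_f_R0 (fun i => Rabs (x i - z i - c)) l).
    { intros k l hkl; induction hkl as [|l hkl IH]; [lra|].
      rewrite tech5; pose proof (Rabs_pos (x (S l) - z (S l) - c)); lra. }
    apply hmono; lia. }
  destruct (INR_unbounded (M / eta)) as [N hN]; exists N; intros n hn.
  assert (hp : 0 < INR (S n)) by (apply lt_0_INR; lia).
  apply (Rmult_le_reg_r (INR (S n))); [exact hp|].
  unfold Rdiv at 1; rewrite Rmult_assoc, Rinv_l, Rmult_1_r by lra.
  apply le_INR in hn.
  assert (hMN : M <= eta * INR (S n)).
  { rewrite S_INR; apply (Rmult_le_reg_r (/ eta)); [apply Rinv_0_lt_compat, heta|].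
    replace (eta * (INR n + 1) * / eta) with (INR n + 1) by (field; lra).
    unfold Rdiv in hN; lra. }
  specialize (hM n); specialize (h2 n); lra.
Qed.

(** * A one-sided Hajek-Renyi inequality *)

Section HajekRenyi.
Context {Om : Type} {F : (Om -> Prop) -> Prop} {H : (Om -> R) -> Prop}
  {e : (Om -> R) -> R} (U : upper_exp F H e)
  {Ft : nat -> (Om -> Prop) -> Prop} (Fts : forall t, is_sigma_algebra (Ft t))
  (Ftm : forall s t A, (s <= t)%nat -> Ft s A -> Ft t A)
  (FtF : forall t A, Ft t A -> F A).

(** Sums with exactly [n] terms, the empty one included, so that [psum Z n] is known at time [n]. *)
Fixpoint psum (Z : nat -> Om -> R) (n : nat) (w : Om) : R :=
  match n with O => 0 | S k => psum Z k w + Z k w end.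

Lemma psum_sum Z n w : psum Z (S n) w = sum_f_R0 (fun i => Z i w) n.
Proof. induction n as [|n IH]; simpl in *; [ring|rewrite IH; reflexivity]. Qed.

(* The process [(psum^+ / n)^2] stopped once it exceeds [lam^2]. *)
Fixpoint stopped_sqr (Z : nat -> Om -> R) (lam : R) (n : nat) (w : Om) : R :=
  match n with
  | O => 0
  | S k => if Rlt_dec (lam ^ 2) (stopped_sqr Z lam k w) then stopped_sqr Z lam k w
           else (Rmax (psum Z (S k) w) 0 / INR (S k)) ^ 2
  end.

(** Since [((x + z)^+)^2 <= (x^+ + z)^2], expanding the square leaves a cross term with the
    nonnegative weight [2 x^+ / k^2]. The case [j = 0] is the first step, where the partial sum is
    empty and [x = 0]. *)
Lemma sqr_pos_part_step x z j k : 0 <= j -> 0 < k -> j <= k -> (j = 0 -> x = 0) ->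
  (Rmax (x + z) 0 / k) ^ 2
  <= (Rmax x 0 / j) ^ 2 + 2 * Rmax x 0 / k ^ 2 * z + z * z * / k ^ 2.
Proof.
  intros hj hk hjk hx.
  assert (hk2 : 0 < / k ^ 2) by (apply Rinv_0_lt_compat; nra).
  set (p := Rmax x 0).
  assert (hp : 0 <= p) by apply Rmax_r.
  assert (hxp : x <= p) by apply Rmax_l.
  assert (h1 : (Rmax (x + z) 0) ^ 2 <= (p + z) ^ 2).
  { unfold Rmax; destruct (Rle_dec (x + z) 0); [rewrite pow_i by lia; apply pow2_ge_0|apply pow_incr; lra]. }
  assert (h2 : p ^ 2 * / k ^ 2 <= (p / j) ^ 2).
  { destruct (Req_dec j 0) as [h0|h0].
    - unfold p; rewrite (hx h0), Rmax_right by lra; unfold Rdiv; rewrite !Rmult_0_l; simpl; lra.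
    - unfold Rdiv; rewrite Rpow_mult_distr, pow_inv; apply Rmult_le_compat_l; [nra|].
      apply Rinv_le_contravar; [|apply pow_incr]; nra. }
  unfold Rdiv at 1; rewrite Rpow_mult_distr, pow_inv.
  replace (2 * p / k ^ 2 * z) with (2 * p * z * / k ^ 2) by (unfold Rdiv; ring).
  apply Rle_trans with ((p + z) ^ 2 * / k ^ 2); [apply Rmult_le_compat_r; lra|].
  replace ((p + z) ^ 2 * / k ^ 2) with (p ^ 2 * / k ^ 2 + 2 * p * z * / k ^ 2 + z * z * / k ^ 2)
    by ring; lra.
Qed.

(** Each step raises the expectation of the stopped square by at most the variance term: the cross
    term is [Z n] times a nonnegative simple weight known at time [n], hence has expectation at most
    0. Once above [lam^2] the stopped square stays there, so the crossing events increase, and the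
    Markov inequality with [V_up] bounds their union. *)
Lemma hajek_renyi (Z : nat -> Om -> R) (lam B : R) : 0 < lam ->
  (forall i, simple (Ft (S i)) (Z i)) ->
  (forall i A, Ft i A -> e (fun w => indic A w * Z i w) <= 0) ->
  (forall n, sum_f_R0 (fun i => / INR (S i) ^ 2 * e (fun w => Z i w * Z i w)) n <= B) ->
  e (indic (fun w => exists n, lam * INR (S n) < sum_f_R0 (fun i => Z i w) n)) <= B / lam ^ 2.
Proof.
  intros hlam hZ hneg hB.
  assert (hlam2 : 0 < lam ^ 2) by (apply pow_lt, hlam).
  pose (Q := stopped_sqr Z lam).
  assert (hQS : forall n w, Q (S n) w = if Rlt_dec (lam ^ 2) (Q n w) then Q n w
    else (Rmax (psum Z (S n) w) 0 / INR (S n)) ^ 2) by reflexivity.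
  assert (hT : forall n, simple (Ft n) (psum Z n)).
  { induction n as [|n IH]; simpl; [apply simple_const, Fts|].
    apply (simple_comp2 (Ft (S n)) Rplus); [apply Fts| |apply hZ].
    apply (simple_mono (Ft n)); [intros A; apply Ftm; lia|exact IH]. }
  assert (hQ : forall n, simple (Ft n) (Q n)).
  { induction n as [|n IH]; simpl; [apply simple_const, Fts|].
    apply (simple_comp2 (Ft (S n))
      (fun q t => if Rlt_dec (lam ^ 2) q then q else (Rmax t 0 / INR (S n)) ^ 2)
      (Q n) (psum Z (S n))); [apply Fts| |apply hT].
    apply (simple_mono (Ft n)); [intros A; apply Ftm; lia|exact IH]. }
  assert (hQH : forall n, H (Q n)).
  { intros n; apply (H_simple U), (simple_mono (Ft n)); auto; intros A; apply FtF. }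
  assert (hZH : forall n, simple F (Z n)).
  { intros n; apply (simple_mono (Ft (S n))); auto; intros A; apply FtF. }
  assert (hZZ : forall n, H (fun w => Z n w * Z n w)).
  { intros n; apply (H_simple U), (simple_comp F (fun x => x * x)); [apply (ue_sa _ _ _ U)|apply hZH]. }
  (* Before stopping, [Q] is the plain square. At [n = 0] both sides vanish, because the numerator
     of the quotient is 0. *)
  assert (hQT : forall n w, ~ lam ^ 2 < Q n w -> Q n w = (Rmax (psum Z n w) 0 / INR n) ^ 2).
  { intros [|n] w h.
    - simpl; rewrite Rmax_right by lra; unfold Rdiv; rewrite !Rmult_0_l; reflexivity.
    - rewrite hQS in h |- *; destruct (Rlt_dec _ (Q n w)); tauto. }
  assert (hQpos : forall n w, 0 <= Q n w).
  { induction n as [|n IH]; intros w; [apply Rle_refl|rewrite hQS].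
    destruct (Rlt_dec _ _); [apply IH|apply pow2_ge_0]. }
  (* The weight of the cross term, set to 0 after stopping. *)
  pose (L := fun n w => if Rlt_dec (lam ^ 2) (Q n w) then 0
    else 2 * Rmax (psum Z n w) 0 / INR (S n) ^ 2).
  assert (hk : forall n, 0 < INR (S n)) by (intros n; apply lt_0_INR; lia).
  assert (hL : forall n w, 0 <= L n w).
  { intros n w; unfold L; destruct (Rlt_dec _ _); [lra|].
    apply Rmult_le_pos; [pose proof (Rmax_r (psum Z n w) 0); lra|].
    apply Rlt_le, Rinv_0_lt_compat, pow_lt, hk. }
  assert (hLZ : forall n, H (fun w => L n w * Z n w) /\ e (fun w => L n w * Z n w) <= 0).
  { intros n; apply (e_simple_mul_nonpos U (Ft n)); auto.
    - apply FtF.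
    - apply (simple_comp2 (Ft n)
        (fun q t => if Rlt_dec (lam ^ 2) q then 0 else 2 * Rmax t 0 / INR (S n) ^ 2)
        (Q n) (psum Z n)); auto.
    - apply (H_simple U), hZH. }
  assert (hstep : forall n, e (Q (S n)) <= e (Q n) + / INR (S n) ^ 2 * e (fun w => Z n w * Z n w)).
  { intros n; destruct (hLZ n) as [h1 h2].
    assert (hik : 0 <= / INR (S n) ^ 2) by (apply Rlt_le, Rinv_0_lt_compat, pow_lt, hk).
    assert (h3 : H (fun w => / INR (S n) ^ 2 * (Z n w * Z n w))) by (apply (H_scal U), hZZ).
    apply Rle_trans with (e (fun w => Q n w + L n w * Z n w + / INR (S n) ^ 2 * (Z n w * Z n w))).
    - apply (ue_mono _ _ _ U); [apply hQH| |].
      { apply (H_plus U); [apply (H_plus U); auto|exact h3]. }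
      intros w; specialize (hQT n w); unfold L; rewrite hQS.
      destruct (Rlt_dec (lam ^ 2) (Q n w)) as [hq|hq].
      + enough (0 <= / INR (S n) ^ 2 * (Z n w * Z n w)) by lra.
        apply Rmult_le_pos; [exact hik|nra].
      + rewrite (hQT hq).
        rewrite (Rmult_comm (/ _)).
        apply sqr_pos_part_step; [apply pos_INR|apply hk|apply le_INR; lia|].
        destruct n; [reflexivity|intros h; specialize (hk n); lra].
    - pose proof (ue_sub _ _ _ U _ _ (H_plus U _ _ (hQH n) h1) h3) as h4.
      pose proof (ue_sub _ _ _ U _ _ (hQH n) h1) as h5.
      pose proof (ue_hom _ _ _ U _ _ hik (hZZ n)) as h6.
      simpl in h4, h5, h6 |- *; lra. }
  assert (hQB : forall n, e (Q n) <= B).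
  { assert (h0 : e (Q 0%nat) = 0) by exact (ue_const _ _ _ U 0).
    assert (h : forall n, e (Q (S n)) <=
      sum_f_R0 (fun i => / INR (S i) ^ 2 * e (fun w => Z i w * Z i w)) n).
    { induction n as [|n IH]; [|rewrite tech5; specialize (hstep (S n)); lra].
      specialize (hstep 0%nat); cbn [sum_f_R0]; lra. }
    intros [|n]; [|eapply Rle_trans; [apply h|apply hB]].
    rewrite h0.
    eapply Rle_trans; [|apply (hB 0%nat)]; cbn [sum_f_R0].
    apply Rmult_le_pos; [apply Rlt_le, Rinv_0_lt_compat, pow_lt, hk|].
    apply (e_nonneg U); [apply hZZ|intros w; apply Rle_0_sqr]. }
  assert (hF : forall n, F (fun w => lam ^ 2 < Q n w)).
  { intros n; apply (meas_gt (ue_sa _ _ _ U)), (H_meas U), hQH. }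
  apply Rle_trans with (e (indic (fun w => exists n, lam ^ 2 < Q n w))).
  - apply (V_mono U).
    + apply (sa_cunion (ue_sa _ _ _ U)
        (fun n w => lam * INR (S n) < sum_f_R0 (fun i => Z i w) n)); intros n.
      apply (meas_gt (ue_sa _ _ _ U)), (meas_sum (ue_sa _ _ _ U)); intros i _; apply hZH.
    + apply (sa_cunion (ue_sa _ _ _ U)), hF.
    (* A crossing by the partial sum of [n + 1] terms puts the stopped square above [lam^2] at time
       [n + 1], unless it was already there. *)
    + intros w [n hn]; exists (S n); rewrite <- psum_sum in hn.
      rewrite hQS.
      destruct (Rlt_dec (lam ^ 2) (Q n w)) as [hq|hq]; [exact hq|].
      assert (hl : lam < Rmax (psum Z (S n) w) 0 / INR (S n)).
      { apply (Rmult_lt_reg_r (INR (S n))); [apply hk|].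
        unfold Rdiv; rewrite Rmult_assoc, Rinv_l, Rmult_1_r by (specialize (hk n); lra).
        eapply Rlt_le_trans; [exact hn|apply Rmax_l]. }
      nra.
  - apply (V_up U); [exact hF| |].
    + intros n w h; rewrite hQS; destruct (Rlt_dec _ _); tauto.
    + intros n; eapply Rle_trans; [apply (e_markov U); auto|].
      apply Rmult_le_compat_r; [apply Rlt_le, Rinv_0_lt_compat, hlam2|apply hQB].
Qed.

End HajekRenyi.

(** * Rounding *)

(** For [d > 0] this is the least multiple of [d] strictly above [x], since [up] is strictly above
    its argument. *)
Definition roundup (d x : R) : R := d * IZR (up (x / d)).

Lemma roundup_bounds d x : 0 < d -> x <= roundup d x <= x + d.
Proof.
  intros hd; unfold roundup; destruct (archimed (x / d)) as [h1 h2].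
  assert (hx : x = d * (x / d)) by (field; lra).
  split.
  - rewrite hx at 1; apply Rmult_le_compat_l; lra.
  - rewrite hx at 2; nra.
Qed.

(** The condition [roundup d x <= t] says that [up (x / d)] is at most [up (t / d) - 1], the integer
    part of [t / d]; this is an open half-line ending at a grid point. *)
Lemma borel_roundup d : 0 < d -> borel_fun (roundup d).
Proof.
  intros hd t.
  apply (sa_ext borel (fun x => x < d * IZR (up (t / d) - 1))).
  { apply (meas_lt borel_sa), borel_id. }
  intros x; unfold roundup.
  destruct (archimed (x / d)) as [h1 h2], (archimed (t / d)) as [h3 h4].
  assert (hx : x = d * (x / d)) by (field; lra).
  assert (ht : t = d * (t / d)) by (field; lra).
  rewrite minus_IZR; split; intros h.
  - assert (hz : (up (x / d) <= up (t / d) - 1)%Z).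
    { apply Z.lt_succ_r, lt_IZR; unfold Z.succ; rewrite plus_IZR, minus_IZR.
      assert (x / d < IZR (up (t / d)) - 1) by (apply (Rmult_lt_reg_l d); lra); lra. }
    apply IZR_le in hz; rewrite minus_IZR in hz.
    rewrite ht; apply Rmult_le_compat_l; lra.
  - assert (hz : (up (x / d) <= up (t / d) - 1)%Z).
    { apply Z.lt_le_pred, lt_IZR.
      assert (IZR (up (x / d)) <= t / d) by (apply (Rmult_le_reg_l d); lra); lra. }
    apply IZR_le in hz; rewrite minus_IZR in hz.
    rewrite hx; apply Rmult_lt_compat_l; lra.
Qed.

Definition trunc_round (d k x : R) : R := if Rle_dec (Rabs x) k then roundup d x else 0.

Lemma simple_trunc_round d k : 0 < d -> simple borel (trunc_round d k).
Proof.
  intros hd; split.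
  - apply (meas_if borel_sa (fun x => Rabs x <= k) (roundup d) (fun _ => 0)
      (fun x => Rle_dec (Rabs x) k)).
    + apply (meas_abs borel_sa), borel_id.
    + apply borel_roundup, hd.
    + apply (meas_const borel_sa).
  (* Grid indices lie between [- K] and [K]; they are shifted by [K] to be enumerated by
     naturals. *)
  - pose (K := Z.to_nat (up (k / d))).
    exists (0 :: map (fun j => d * IZR (Z.of_nat j - Z.of_nat K)) (seq 0 (2 * K + 1))).
    intros x; unfold trunc_round; destruct (Rle_dec (Rabs x) k) as [h|h]; [right|left; reflexivity].
    assert (hxk : - (k / d) <= x / d <= k / d).
    { pose proof (Rle_abs x); pose proof (Rle_abs (- x)); rewrite Rabs_Ropp in *.
      assert (hi : 0 < / d) by (apply Rinv_0_lt_compat, hd).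
      unfold Rdiv; split; nra. }
    destruct (archimed (x / d)) as [h1 h2], (archimed (k / d)) as [h3 h4].
    assert (hz1 : (up (x / d) < up (k / d) + 1)%Z) by (apply lt_IZR; rewrite plus_IZR; lra).
    assert (hz2 : (- up (k / d) < up (x / d))%Z) by (apply lt_IZR; rewrite opp_IZR; lra).
    apply in_map_iff; exists (Z.to_nat (up (x / d) + Z.of_nat K)); split.
    + unfold roundup; do 2 f_equal; unfold K; lia.
    + apply in_seq; unfold K; lia.
Qed.

Lemma simple_borel_comp {T} (S : (T -> Prop) -> Prop) h f : is_sigma_algebra S ->
  simple borel h -> measurable S f -> simple S (fun w => h (f w)).
Proof.
  intros HS [hm [l hl]] hf; split; [apply (meas_comp HS); assumption|exists l; auto].
Qed.

(** * Independent identically distributed sequences *)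

(** The event [m - 1 < |X| <= m] of the summability condition with [m = k + 1]. *)
Definition shell {T : Type} (X : T -> R) (k : nat) (w : T) : Prop :=
  INR k < Rabs (X w) <= INR (S k).

(** On shell [m] one has [X^2 <= (m + 1) |X|]. The value 0 lies in no shell and is treated apart.
    This turns truncated second moments into weighted sums of shell masses. *)
Lemma sqr_le_shell_sum {T : Type} (X : T -> R) w i : Rabs (X w) <= INR (S i) ->
  X w * X w <= sum_f_R0 (fun m => INR (S m) * (Rabs (X w) * indic (shell X m) w)) i.
Proof.
  assert (hsq : X w * X w = Rabs (X w) * Rabs (X w)).
  { rewrite <- Rabs_mult, Rabs_pos_eq; [reflexivity|apply Rle_0_sqr]. }
  pose proof (Rabs_pos (X w)) as hp; rewrite hsq.
  assert (hs : forall m, Rabs (X w) <= INR (S m) -> INR m < Rabs (X w) \/ X w = 0 ->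
    Rabs (X w) * Rabs (X w) <= INR (S m) * (Rabs (X w) * indic (shell X m) w)).
  { intros m hm [hl|h0].
    - rewrite indic_1 by (split; assumption); nra.
    - rewrite h0, Rabs_R0; lra. }
  induction i as [|i IH]; intros h.
  - apply hs; [exact h|]; destruct (Req_dec (X w) 0) as [h0|h0]; [right; exact h0|left].
    apply Rabs_pos_lt, h0.
  - rewrite tech5; destruct (Rle_dec (Rabs (X w)) (INR (S i))) as [hl|hl].
    + specialize (IH hl).
      enough (0 <= INR (S (S i)) * (Rabs (X w) * indic (shell X (S i)) w)) by lra.
      apply Rmult_le_pos; [apply pos_INR|apply Rmult_le_pos; [exact hp|]].
      destruct (indic_cases (shell X (S i)) w) as [[_ ->]|[_ ->]]; lra.
    + specialize (hs (S i) h (or_introl (Rnot_le_lt _ _ hl))).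
      enough (0 <= sum_f_R0 (fun m => INR (S m) * (Rabs (X w) * indic (shell X m) w)) i) by lra.
      apply cond_pos_sum; intros m.
      apply Rmult_le_pos; [apply pos_INR|apply Rmult_le_pos; [exact hp|]].
      destruct (indic_cases (shell X m) w) as [[_ ->]|[_ ->]]; lra.
Qed.

(** The consequences of independence and identical distribution that the proof uses, in a form
    stable under Borel maps, such as negation and translation. [X i] is known at time [i + 1] and
    independent of the past up to time [i]. *)
Record admissible {Om : Type} (Ft : nat -> (Om -> Prop) -> Prop) (H : (Om -> R) -> Prop)
  (e : (Om -> R) -> R) (X : nat -> Om -> R) : Prop := {
  adm_H : forall i, H (X i);
  adm_meas : forall i, measurable (Ft (S i)) (X i);
  adm_indep : forall i A h, Ft i A -> borel_fun h -> H (fun w => h (X i w)) ->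
    e (fun w => indic A w * h (X i w))
    = e (fun w => indic A w * e (fun w' => h (X i w')));
  adm_ident : forall i h, borel_fun h -> H (fun w => h (X i w)) -> H (fun w => h (X 0%nat w)) ->
    e (fun w => h (X i w)) = e (fun w => h (X 0%nat w)) }.

Section UpperLaw.
Context {Om : Type} {F : (Om -> Prop) -> Prop} {H : (Om -> R) -> Prop}
  {e : (Om -> R) -> R} (U : upper_exp F H e)
  {Ft : nat -> (Om -> Prop) -> Prop} (Fts : forall t, is_sigma_algebra (Ft t))
  (Ftm : forall s t A, (s <= t)%nat -> Ft s A -> Ft t A)
  (FtF : forall t A, Ft t A -> F A).

Let Fsa : is_sigma_algebra F := ue_sa _ _ _ U.

Lemma adm_comp X g : admissible Ft H e X -> borel_fun g -> (forall i, H (fun w => g (X i w))) ->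
  admissible Ft H e (fun i w => g (X i w)).
Proof.
  intros hX hg hH; split.
  - exact hH.
  - intros i; apply (meas_comp (Fts _)); [exact hg|apply hX].
  - intros i A h hA hh; apply (adm_indep _ _ _ _ hX i A (fun x => h (g x)) hA).
    apply (meas_comp borel_sa); assumption.
  - intros i h hh; apply (adm_ident _ _ _ _ hX i (fun x => h (g x))).
    apply (meas_comp borel_sa); assumption.
Qed.

(** The limsup event lies in every tail union, whose capacity is at most a tail of the series. *)
Lemma borel_cantelli (A : nat -> Om -> Prop) B : (forall n, F (A n)) ->
  (forall n, sum_f_R0 (fun i => e (indic (A i))) n <= B) ->
  F (fun w => forall m, exists i, (m <= i)%nat /\ A i w) /\
  e (indic (fun w => forall m, exists i, (m <= i)%nat /\ A i w)) = 0.
Proof.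
  intros hA hB.
  assert (hF1 : forall m i, F (fun w => (m <= i)%nat /\ A i w)).
  { intros m i; apply (sa_and Fsa); [apply (sa_const Fsa)|apply hA]. }
  assert (hF2 : forall m, F (fun w => exists i, (m <= i)%nat /\ A i w)).
  { intros m; apply (sa_cunion Fsa), hF1. }
  assert (hF3 : F (fun w => forall m, exists i, (m <= i)%nat /\ A i w)).
  { apply (sa_cinter Fsa), hF2. }
  split; [exact hF3|].
  apply Rle_antisym; [|apply (V_nonneg U), hF3].
  apply Rle_plus_epsilon; intros eta heta.
  destruct (sum_tail_small (fun i => e (indic (A i))) B eta) as [m0 hm0]; auto.
  { intros i; apply (V_nonneg U), hA. }
  specialize (hm0 m0); rewrite Rplus_0_l.
  eapply Rle_trans; [apply (V_mono U _ (fun w => exists i, (m0 <= i)%nat /\ A i w)); auto|].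
  apply (V_cunion U); [apply hF1|].
  intros n; eapply Rle_trans; [|apply (hm0 n), le_n].
  apply sum_Rle; intros i _; destruct (lt_dec i m0) as [hi|hi].
  - rewrite (e_ext (e := e) _ (fun _ => 0)), (ue_const _ _ _ U); [lra|].
    intros w; apply indic_0; lia.
  - apply (V_mono U); auto; tauto.
Qed.

Section Sequence.
Context {X : nat -> Om -> R} (hX : admissible Ft H e X).

Let a k := e (fun w => Rabs (X 0%nat w) * indic (shell (X 0%nat) k) w).

Lemma F_shell k : F (shell (X 0%nat) k).
Proof.
  pose proof (H_meas U _ (adm_H _ _ _ _ hX 0)) as h.
  apply (sa_and Fsa (fun w => INR k < Rabs (X 0%nat w))).
  - apply (meas_gt Fsa), (meas_abs Fsa), h.
  - apply (meas_abs Fsa), h.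
Qed.

Lemma H_shell k : H (fun w => Rabs (X 0%nat w) * indic (shell (X 0%nat) k) w).
Proof.
  apply (H_ext (fun w => indic (shell (X 0%nat) k) w * Rabs (X 0%nat w))); [|intros w; ring].
  apply (H_indmul U); [apply F_shell|apply (H_abs U), hX].
Qed.

Lemma shell_mass_nonneg k : 0 <= a k.
Proof.
  apply (e_nonneg U); [apply H_shell|intros w].
  apply Rmult_le_pos; [apply Rabs_pos|].
  destruct (indic_cases (shell (X 0%nat) k) w) as [[_ ->]|[_ ->]]; lra.
Qed.

(** Summation by parts: the tails [v] drop from [n] to [n + 1] by at most the capacity of shell
    [n + 1], and [k V(shell k) <= a k]. The boundary term [(n + 1) v n] is bounded by the Markov
    inequality. *)
Lemma tail_prob_sum_le B : (forall n, sum_f_R0 a n <= B) -> forall n,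
  sum_f_R0 (fun k => e (indic (fun w => INR (S k) < Rabs (X k w)))) n
  <= B + e (fun w => Rabs (X 0%nat w)).
Proof.
  intros hB n.
  pose (v := fun k => e (indic (fun w => INR (S k) < Rabs (X 0%nat w)))).
  assert (hF : forall i k, F (fun w => INR k < Rabs (X i w))).
  { intros i k; apply (meas_gt Fsa), (meas_abs Fsa), (H_meas U), hX. }
  assert (hv : forall k, e (indic (fun w => INR (S k) < Rabs (X k w))) = v k).
  { intros k; apply (adm_ident _ _ _ _ hX k (indic (fun x => INR (S k) < Rabs x))).
    - apply (meas_indic borel_sa), (meas_gt borel_sa), (meas_abs borel_sa), borel_id.
    - apply (H_indic U (fun w => INR (S k) < Rabs (X k w))), hF.
    - apply (H_indic U (fun w => INR (S k) < Rabs (X 0%nat w))), hF. }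
  rewrite (sum_eq _ v) by (intros; apply hv); clear hv.
  assert (hshell : forall k, INR k * e (indic (shell (X 0%nat) k)) <= a k).
  { intros k; rewrite <- (ue_hom _ _ _ U) by (apply pos_INR || apply (H_indic U), F_shell).
    apply (ue_mono _ _ _ U); [apply (H_scal U), (H_indic U), F_shell|apply H_shell|].
    intros w; destruct (indic_cases (shell (X 0%nat) k) w) as [[[h _] ->]|[_ ->]]; lra. }
  assert (hind : sum_f_R0 v n <= sum_f_R0 a n + INR (S n) * v n).
  { clear hB; induction n as [|n IH].
    - pose proof (shell_mass_nonneg 0); simpl; lra.
    - rewrite !tech5.
      assert (h1 : v n <= e (indic (shell (X 0%nat) (S n))) + v (S n)).
      { apply (V_or U); [apply hF|apply F_shell|apply hF|].
        intros w hw; unfold shell; lra. }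
      specialize (hshell (S n)); pose proof (pos_INR (S n)).
      rewrite (S_INR (S n)); nra. }
  assert (hmk : INR (S n) * v n <= e (fun w => Rabs (X 0%nat w))).
  { assert (hp : 0 < INR (S n)) by (apply lt_0_INR; lia).
    pose proof (e_markov U (fun w => Rabs (X 0%nat w)) (INR (S n)) (H_abs U _ (adm_H _ _ _ _ hX 0))
      hp (fun w => Rabs_pos _)) as h; fold (v n) in h.
    apply (Rmult_le_compat_l (INR (S n))) in h; [|lra].
    replace (INR (S n) * (e (fun w => Rabs (X 0%nat w)) / INR (S n)))
      with (e (fun w => Rabs (X 0%nat w))) in h by (field; lra).
    exact h. }
  specialize (hB n); lra.
Qed.

(** The rounded, truncated and centred variables satisfy the hypotheses of [hajek_renyi] from a late
    enough time on. Restarting later makes the variance sum, and so the crossing probability,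
    arbitrarily small. *)
Lemma upper_lln B eps : (forall n, sum_f_R0 a n <= B) -> 0 < eps ->
  quasi_surely F e (fun w => exists n0, forall n, (n0 <= n)%nat ->
    sum_f_R0 (fun i => X i w) n / INR (S n) <= e (X 0%nat) + eps).
Proof.
  intros hB heps.
  (* The four quarters of [eps] pay for the rounding, the truncated tail, the maximal inequality and
     the early terms; the first two enter the centring constant [c]. *)
  pose (d := eps / 4); assert (hd : 0 < d) by (unfold d; lra).
  pose (c := e (X 0%nat) + 2 * d).
  pose proof (adm_H _ _ _ _ hX) as hH.
  assert (hmX : forall i, measurable F (X i)) by (intros i; apply (H_meas U), hH).
  destruct (borel_cantelli (fun k w => INR (S k) < Rabs (X k w)) _
    (fun k => meas_gt Fsa _ _ (meas_abs Fsa _ (hmX k))) (tail_prob_sum_le B hB)) as [hN1 hN1'].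
  set (N1 := fun w => forall m, exists i, _) in *.
  destruct (e_tail U (X 0%nat) d (hH 0%nat) hd) as [i0 hi0].
  pose (h := fun (i : nat) x => trunc_round d (INR (S i)) x - c).
  assert (hhs : forall i, simple borel (h i)).
  { intros i; apply (simple_comp borel (fun y => y - c)); [apply borel_sa|].
    apply simple_trunc_round, hd. }
  assert (hhH : forall i j, H (fun w => h i (X j w))).
  { intros i j; apply (H_simple U), (simple_borel_comp F (h i)); auto. }
  assert (hhsq : forall i j, H (fun w => h i (X j w) * h i (X j w))).
  { intros i j; apply (H_simple U), (simple_comp F (fun y => y * y)); [exact Fsa|].
    apply (simple_borel_comp F (h i)); auto. }
  assert (hmean : forall i, (i0 <= i)%nat -> e (fun w => h i (X i w)) <= 0).
  { intros i hi; rewrite (adm_ident _ _ _ _ hX i (h i)) by (apply hhs || apply hhH).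
    specialize (hi0 (S i) ltac:(lia)).
    set (Y := fun w => indic (fun w' => INR (S i) < Rabs (X 0%nat w')) w * Rabs (X 0%nat w)) in hi0.
    assert (hY : H Y).
    { apply (H_indmul U); [|apply (H_abs U), hH].
      apply (meas_gt Fsa), (meas_abs Fsa), hmX. }
    apply Rle_trans with (e (fun w => (X 0%nat w + Y w) + (d - c))).
    - apply (ue_mono _ _ _ U); [apply hhH| |].
      { apply (H_plus U); [apply (H_plus U); auto|apply (H_const U)]. }
      intros w; unfold h, Y, trunc_round.
      destruct (Rle_dec (Rabs (X 0%nat w)) (INR (S i))) as [hx|hx].
      + rewrite indic_0 by lra; pose proof (roundup_bounds d (X 0%nat w) hd); lra.
      + rewrite indic_1 by lra; pose proof (Rle_abs (- X 0%nat w)); rewrite Rabs_Ropp in *; lra.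
    - rewrite (e_translate U) by (apply (H_plus U); auto).
      pose proof (ue_sub _ _ _ U (X 0%nat) Y (hH 0%nat) hY); unfold c; lra. }
  pose (q := fun i => sum_f_R0 (fun m => INR (S m) * a m) i).
  (* With [r] the rounding of [x], [(r - c)^2 <= 2 r^2 + 2 c^2] and [r^2 <= 2 x^2 + 2 d^2], whence
     [4 x^2 + K]. *)
  pose (K := 4 * d ^ 2 + 2 * c ^ 2).
  assert (hK : 0 <= K) by (unfold K; pose proof (pow2_ge_0 d); pose proof (pow2_ge_0 c); lra).
  assert (hvar : forall i, e (fun w => h i (X i w) * h i (X i w)) <= 4 * q i + K).
  { intros i; rewrite (adm_ident _ _ _ _ hX i (fun x => h i x * h i x)); [| |apply hhsq|apply hhsq].
    2: apply (simple_comp borel (fun y => y * y)); [apply borel_sa|apply hhs].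
    pose (Q := fun w => sum_f_R0 (fun m => INR (S m) *
      (Rabs (X 0%nat w) * indic (shell (X 0%nat) m) w)) i).
    assert (hQm : forall m, H (fun w => INR (S m) *
      (Rabs (X 0%nat w) * indic (shell (X 0%nat) m) w))).
    { intros m; apply (H_scal U), H_shell. }
    assert (hQ : H Q) by (apply (H_sum U (fun m w => _)), hQm).
    apply Rle_trans with (e (fun w => 4 * Q w + K)).
    - apply (ue_mono _ _ _ U); [apply hhsq| |].
      { apply (H_plus U); [apply (H_scal U), hQ|apply (H_const U)]. }
      intros w; unfold h, trunc_round.
      assert (hQ0 : 0 <= Q w).
      { apply cond_pos_sum; intros m; apply Rmult_le_pos; [apply pos_INR|].
        apply Rmult_le_pos; [apply Rabs_pos|].
        destruct (indic_cases (shell (X 0%nat) m) w) as [[_ ->]|[_ ->]]; lra. }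
      destruct (Rle_dec (Rabs (X 0%nat w)) (INR (S i))) as [hx|hx].
      + pose proof (sqr_le_shell_sum (X 0%nat) w i hx) as hs; fold (Q w) in hs.
        pose proof (roundup_bounds d (X 0%nat w) hd) as hr.
        set (r := roundup d (X 0%nat w)) in *; set (x := X 0%nat w) in *.
        assert (h1 : r * r <= 2 * (x * x) + 2 * (d * d)).
        { replace r with (x + (r - x)) by ring; set (s := r - x).
          assert (hs0 : 0 <= s <= d) by (unfold s; lra).
          pose proof (Rle_0_sqr (x - s)) as h2; unfold Rsqr in h2; nra. }
        pose proof (Rle_0_sqr (r + c)) as h2; unfold Rsqr in h2; unfold K; nra.
      + unfold K; nra.
    - rewrite (e_translate U), (ue_hom _ _ _ U) by (lra || (try apply (H_scal U)); exact hQ).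
      enough (e Q <= q i) by lra.
      eapply Rle_trans; [apply (e_sum_le U (fun m w => _)), hQm|].
      apply sum_Rle; intros m _; rewrite (ue_hom _ _ _ U); [apply Rle_refl|apply pos_INR|apply H_shell]. }
  pose (t := fun i => / INR (S i) ^ 2 * e (fun w => h i (X i w) * h i (X i w))).
  assert (hip : forall i, 0 <= / INR (S i) ^ 2).
  { intros i; apply Rlt_le, Rinv_0_lt_compat, pow_lt, lt_0_INR; lia. }
  assert (ht0 : forall i, 0 <= t i).
  { intros i; apply Rmult_le_pos; [apply hip|].
    apply (e_nonneg U); [apply hhsq|intros w; apply Rle_0_sqr]. }
  assert (htB : forall n, sum_f_R0 t n <= 8 * B + 2 * K).
  { intros n.
    apply Rle_trans with (4 * sum_f_R0 (fun i => q i / INR (S i) ^ 2) n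
      + K * sum_f_R0 (fun i => / INR (S i) ^ 2) n).
    - rewrite !scal_sum, <- plus_sum; apply sum_Rle; intros i _; unfold t.
      specialize (hvar i); specialize (hip i); unfold Rdiv; nra.
    - pose proof (sum_weighted_avg_le a n shell_mass_nonneg) as h1; fold q in h1; simpl in h1.
      pose proof (sum_inv_sqr_le n) as h2; pose proof (inv_INR_S_pos n) as h3.
      assert (hq0 : 0 <= q n).
      { apply cond_pos_sum; intros m; apply Rmult_le_pos; [apply pos_INR|apply shell_mass_nonneg]. }
      assert (h4 : 0 <= q n / INR (S n)) by (apply Rmult_le_pos; lra).
      specialize (hB n); cbv zeta in h1; fold q in h1.
      assert (sum_f_R0 (fun i => q i / INR (S i) ^ 2) n <= 2 * B) by (simpl in *; lra).
      nra. }
  (* The sequence restarted at time [m]; [A m] is the event that its averages ever exceed [d]. *)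
  pose (Z := fun m i w => if lt_dec i m then 0 else h i (X i w)).
  pose (A := fun m w => exists n, d * INR (S n) < sum_f_R0 (fun i => Z m i w) n).
  assert (hZs : forall m i, simple (Ft (S i)) (Z m i)).
  { intros m i; unfold Z; destruct (lt_dec i m); [apply simple_const, Fts|].
    apply (simple_borel_comp (Ft (S i)) (h i)); auto; apply hX. }
  assert (hA : forall m, F (A m)).
  { intros m; apply (sa_cunion Fsa (fun n w => d * INR (S n) < sum_f_R0 (fun i => Z m i w) n)).
    intros n; apply (meas_gt Fsa), (meas_sum Fsa); intros i _.
    apply (meas_mono (Ft (S i))); [apply FtF|apply hZs]. }
  assert (hVA : forall eta, 0 < eta -> exists m, (i0 <= m)%nat /\ e (indic (A m)) <= eta).
  { intros eta heta.
    assert (hd2 : 0 < d ^ 2) by (apply pow_lt, hd).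
    destruct (sum_tail_small t _ (eta * d ^ 2) ht0 htB) as [m0 hm0].
    { apply Rmult_lt_0_compat; assumption. }
    exists (Nat.max i0 m0); split; [lia|]; set (m := Nat.max i0 m0).
    replace eta with (eta * d ^ 2 / d ^ 2) by (field; lra).
    apply (hajek_renyi U Fts Ftm FtF (Z m) d); [exact hd|apply hZs| |].
    - intros i A' hA'; unfold Z; destruct (lt_dec i m) as [hi|hi].
      + rewrite (e_ext (e := e) _ (fun _ => 0)), (ue_const _ _ _ U); [lra|intros w; ring].
      (* Independence replaces [h i (X i)] by its mean, which is at most 0 because
         [i >= m >= i0]. *)
      + rewrite (adm_indep _ _ _ _ hX i A' (h i)) by (assumption || apply hhs || apply hhH).
        rewrite <- (ue_const _ _ _ U 0).
        apply (ue_mono _ _ _ U); [|apply (H_const U)|].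
        { apply (H_indmul U); [exact (FtF _ _ hA')|apply (H_const U)]. }
        intros w; specialize (hmean i ltac:(lia)).
        destruct (indic_cases A' w) as [[_ ->]|[_ ->]]; lra.
    - intros n; eapply Rle_trans; [|apply (hm0 m n); lia].
      apply sum_Rle; intros i _; unfold Z, t; destruct (lt_dec i m); [|apply Rle_refl].
      rewrite (e_ext (e := e) _ (fun _ => 0)), (ue_const _ _ _ U); [lra|intros w; ring]. }
  (* The capacities of the [A m] become arbitrarily small, so their intersection is null; off it
     some restarted sequence never crosses. *)
  pose (N2 := fun w => forall m, (i0 <= m)%nat -> A m w).
  assert (hN2 : F N2).
  { apply (sa_cinter Fsa (fun m w => (i0 <= m)%nat -> A m w)); intros m.
    apply (sa_ext F (fun w => ~ (i0 <= m)%nat \/ A m w)).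
    - apply (sa_or Fsa); [apply (sa_const Fsa)|apply hA].
    - intros w; destruct (le_dec i0 m); tauto. }
  assert (hN2' : e (indic N2) = 0).
  { apply Rle_antisym; [|apply (V_nonneg U), hN2].
    apply Rle_plus_epsilon; intros eta heta; destruct (hVA eta heta) as [m [hm hVm]].
    rewrite Rplus_0_l; eapply Rle_trans; [|exact hVm].
    apply (V_mono U); auto; intros w hw; exact (hw m hm). }
  exists (fun w => N1 w \/ N2 w).
  assert (hN : F (fun w => N1 w \/ N2 w)) by (apply (sa_or Fsa); assumption).
  split; [exact hN|split].
  - apply Rle_antisym; [|apply (V_nonneg U), hN].
    apply Rle_trans with (e (indic N1) + e (indic N2)); [apply (V_or U); auto|lra].
  - intros w hw; apply not_or_and in hw; destruct hw as [hw1 hw2].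
    apply not_all_ex_not in hw1; destruct hw1 as [i1 hw1].
    apply not_all_ex_not in hw2; destruct hw2 as [m hw2].
    destruct (average_eventually_le (fun i => X i w) (fun i => Z m i w) c d (Nat.max i1 m) d hd)
      as [n0 hn0].
    + intros i hi; unfold Z; destruct (lt_dec i m); [lia|].
      unfold h, trunc_round; destruct (Rle_dec (Rabs (X i w)) (INR (S i))) as [hx|hx].
      * pose proof (roundup_bounds d (X i w) hd); lra.
      * destruct hw1; exists i; split; [lia|lra].
    + intros n; apply Rnot_lt_le; intros hn; apply hw2; intros _; exists n; exact hn.
    + exists n0; intros n hn; specialize (hn0 n hn); unfold c, d in hn0 |- *; lra.
Qed.

End Sequence.
End UpperLaw.

(** * The lower bound for the limit *)

Lemma psum_split {Om : Type} (X : nat -> Om -> R) n m w :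
  psum X (n + m) w = psum X n w + psum (fun i => X (n + i)%nat) m w.
Proof.
  induction m as [|m IH]; [rewrite Nat.add_0_r; simpl; ring|].
  rewrite Nat.add_succ_r; simpl; rewrite IH; ring.
Qed.

Section SublinearLaw.
Context {Om : Type} {F : (Om -> Prop) -> Prop} {Ft : nat -> (Om -> Prop) -> Prop}
  {H : (Om -> R) -> Prop} {E : nat -> (Om -> R) -> (Om -> R)}
  (HF : filtration F Ft) (HH : is_space F H) (HE : SL_expectation Ft H E) (w0 : Om).

Let e (X : Om -> R) : R := E 0%nat X w0.

Lemma filtration_sa t : is_sigma_algebra (Ft t).
Proof. apply HF. Qed.

Lemma filtration_mono s t A : (s <= t)%nat -> Ft s A -> Ft t A.
Proof. apply HF. Qed.

Lemma filtration_sub t A : Ft t A -> F A.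
Proof. intros h; apply HF, sigma_gen_base; exists t; exact h. Qed.

Lemma filtration_top : is_sigma_algebra F.
Proof.
  replace F with (sigma_gen (fun B => exists t, Ft t B)); [apply sigma_gen_sa|].
  apply functional_extensionality; intros A; apply propositional_extensionality.
  split; apply HF.
Qed.

(** The sublevel set of [E 0 X] at its value in [v'] belongs to the trivial [Ft 0] and contains
    [v'], so it is the whole space. *)
Lemma SL_const X w : H X -> E 0%nat X w = e X.
Proof.
  intros hX; destruct HE as (h1 & _); destruct (h1 0%nat X hX) as [_ hm].
  destruct HF as (_ & _ & htriv & _).
  assert (h : forall w w', E 0%nat X w <= E 0%nat X w').
  { intros v v'; destruct (htriv _ (hm (E 0%nat X v'))) as [h|h]; [|apply h].
    destruct (h v'); apply Rle_refl. }
  apply Rle_antisym; apply h.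
Qed.

Lemma SL_upper_exp : upper_exp F H e.
Proof.
  destruct HE as (h1 & h2 & h3 & h4 & h5 & h6 & h7 & h8).
  destruct HH as (g1 & g2 & g3 & g4 & g5 & g6).
  assert (hc : forall c, Ht Ft H 0 (fun _ => c)).
  { intros c; split; [apply g2|apply meas_const, filtration_sa]. }
  split; unfold e.
  - exact filtration_top.
  - exact HH.
  - intros X Y hX hY h; apply h2; assumption.
  - intros X Y hX hY; apply h6; assumption.
  - intros a X ha hX; rewrite (h7 0%nat (fun _ => a) X (hc a) hX w0).
    rewrite Rmax_left, Rmax_right by lra; ring.
  - intros c; apply h5, hc.
  - intros Xs hX hd h0; apply h8; assumption.
Qed.

Let U := SL_upper_exp.

(** Subadditivity applied to [X = (W + X) + (- W)], where [- W] is its own conditional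
    expectation. *)
Lemma SL_translate t W X w : Ht Ft H t W -> H X ->
  W w + E t X w <= E t (fun w' => W w' + X w') w.
Proof.
  intros [hW hm] hX; destruct HE as (_ & _ & _ & _ & h5 & h6 & _).
  assert (hW' : Ht Ft H t (fun w => - W w)).
  { split; [apply (H_opp U), hW|apply (meas_opp (filtration_sa t)), hm]. }
  pose proof (h6 t (fun w' => W w' + X w') (fun w' => - W w') (H_plus U _ _ hW hX) (proj1 hW') w) as h.
  rewrite (h5 t _ hW') in h.
  replace (fun w' => W w' + X w' + - W w') with X in h; [lra|].
  apply functional_extensionality; intros v; ring.
Qed.

Section Sequence.
Context {X : nat -> Om -> R} (hX : admissible Ft H e X).

Let a := e (X 0%nat).

(* Testing independence on [{E i (X i) <= a - eps}] shows that this event is null. *)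
Lemma cond_exp_deficit i : e (fun w => Rmax (a - E i (X i) w) 0) <= 0.
Proof.
  destruct HE as (h1 & h2 & h3 & h4 & h5 & h6 & _).
  pose proof (adm_H _ _ _ _ hX i) as hXi.
  destruct (h1 i (X i) hXi) as [hG hGm].
  set (P := fun w => Rmax (a - E i (X i) w) 0).
  assert (hP : H P) by (apply (H_max0 U), (H_minus U); [apply (H_const U)|exact hG]).
  apply Rle_plus_epsilon; intros eps heps; rewrite Rplus_0_l.
  pose (N := fun w => E i (X i) w <= a - eps).
  assert (hN : Ft i N) by apply hGm.
  assert (hNF : F N) by (exact (filtration_sub _ _ hN)).
  assert (hY : forall c, H (fun w => X i w + c)).
  { intros c; apply (H_plus U); [exact hXi|apply (H_const U)]. }
  assert (hVN : e (indic N) = 0).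
  (* The shift gives [f (X i)] mean [eps], so independence yields [eps V(N)], while on [N] the
     conditional expectation of [f (X i)] is at most 0. *)
  { pose (f := fun x => x + (eps - a)).
    pose proof (adm_indep _ _ _ _ hX i N f hN) as hi; unfold f in hi.
    assert (hb : borel_fun f).
    { apply (meas_plus borel_sa); [apply borel_id|apply (meas_const borel_sa)]. }
    specialize (hi hb (hY _)).
    rewrite (e_translate U) in hi by exact hXi.
    assert (hid : e (X i) = a).
    { exact (adm_ident _ _ _ _ hX i (fun x => x) borel_id hXi (adm_H _ _ _ _ hX 0)). }
    rewrite hid in hi; replace (a + (eps - a)) with eps in hi by ring.
    rewrite (e_ext (e := e) (fun w => indic N w * eps) (fun w => eps * indic N w)) in hi
      by (intros w; ring).
    rewrite (ue_hom _ _ _ U) in hi by (lra || apply (H_indic U), hNF).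
    assert (hle : e (fun w => indic N w * (X i w + (eps - a))) <= 0).
    { unfold e; rewrite <- (h3 0%nat i) by (lia || apply (H_indmul U); auto).
      rewrite <- (ue_const _ _ _ U 0).
      apply (ue_mono _ _ _ U); [apply h1, (H_indmul U); auto|apply (H_const U)|].
      intros w; rewrite h4 by auto.
      destruct (indic_cases N w) as [[hw ->]|[hw ->]]; [|lra].
      pose proof (h6 i (X i) (fun _ => eps - a) hXi (H_const U _) w) as h.
      rewrite (h5 i (fun _ => eps - a)) in h; [unfold N in hw; lra|].
      split; [apply (H_const U)|apply meas_const, filtration_sa]. }
    apply Rle_antisym; [|apply (V_nonneg U), hNF].
    assert (0 <= e (indic N)) by apply (V_nonneg U), hNF; nra. }
  apply Rle_trans with (e (fun w => eps + indic N w * P w)).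
  (* Off [N] the deficit is below [eps]; on the null set [N] it may be unbounded, which [e_null]
     handles. *)
  - apply (ue_mono _ _ _ U); [exact hP|apply (H_plus U); [apply (H_const U)|apply (H_indmul U); auto]|].
    intros w; destruct (indic_cases N w) as [[hw ->]|[hw ->]]; [lra|].
    unfold P, N in *; unfold Rmax; destruct (Rle_dec _ _); lra.
  - rewrite (e_ext (e := e) _ (fun w => indic N w * P w + eps)) by (intros w; ring).
    rewrite (e_translate U) by (apply (H_indmul U); auto).
    pose proof (e_null U N P hNF hVN hP); lra.
Qed.

(** Conditioning at time [i] pulls out [A] and [W] and leaves [E i (X i)], which falls below [a]
    only by a deficit of expectation at most 0. *)
Lemma cond_step i A W : Ft i A -> Ht Ft H i W ->
  e (fun w => indic A w * (W w + a)) <= e (fun w => indic A w * (W w + X i w)).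
Proof.
  intros hA hW; destruct HE as (h1 & h2 & h3 & h4 & h5 & h6 & _).
  pose proof (adm_H _ _ _ _ hX i) as hXi; pose proof (filtration_sub _ _ hA) as hAF.
  destruct hW as [hWH hWm]; destruct (h1 i (X i) hXi) as [hG hGm].
  assert (hWX : H (fun w => W w + X i w)) by (apply (H_plus U); assumption).
  assert (hAWX : H (fun w => indic A w * (W w + X i w))) by (apply (H_indmul U); assumption).
  assert (hP : H (fun w => Rmax (a - E i (X i) w) 0)).
  { apply (H_max0 U), (H_minus U); [apply (H_const U)|exact hG]. }
  apply Rle_trans with (e (fun w => E i (fun v => indic A v * (W v + X i v)) w
    + Rmax (a - E i (X i) w) 0)).
  - apply (ue_mono _ _ _ U).
    + apply (H_indmul U); [exact hAF|apply (H_plus U); [exact hWH|apply (H_const U)]].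
    + apply (H_plus U); [apply h1, hAWX|exact hP].
    + intros w; rewrite h4 by assumption.
      pose proof (SL_translate i W (X i) w (conj hWH hWm) hXi).
      pose proof (Rmax_l (a - E i (X i) w) 0); pose proof (Rmax_r (a - E i (X i) w) 0).
      destruct (indic_cases A w) as [[_ ->]|[_ ->]]; lra.
  - eapply Rle_trans; [apply (ue_sub _ _ _ U); [apply h1, hAWX|exact hP]|].
    pose proof (cond_exp_deficit i) as hd.
    assert (ht : e (E i (fun v => indic A v * (W v + X i v)))
      = e (fun w => indic A w * (W w + X i w))) by (apply h3; [lia|exact hAWX]).
    change (fun w => E i (fun v => indic A v * (W v + X i v)) w)
      with (E i (fun v => indic A v * (W v + X i v))).
    lra.
Qed.

(** Since [e] is not additive, the summands cannot be treated separately: the last one is replaced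
    by [a] with the earlier ones kept inside [W], and the constant [K] collects the means already
    substituted. *)
Lemma block_lower n m A K : Ft n A ->
  e (fun w => indic A w * (K + INR m * a))
  <= e (fun w => indic A w * (K + psum (fun i => X (n + i)%nat) m w)).
Proof.
  intros hA.
  assert (hS : forall m, Ht Ft H (n + m) (psum (fun i => X (n + i)%nat) m)).
  { clear m; induction m as [|m [IH1 IH2]]; simpl.
    - split; [apply (H_const U)|apply meas_const, filtration_sa].
    - split; [apply (H_plus U); [exact IH1|apply hX]|].
      rewrite Nat.add_succ_r; apply (meas_plus (filtration_sa _)); [|apply hX].
      apply (meas_mono (Ft (n + m))); [|exact IH2].
      intros B; apply filtration_mono; lia. }
  revert K; induction m as [|m IH]; intros K.
  - simpl; rewrite Rmult_0_l; apply Rle_refl.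
  - specialize (IH (K + a)).
    rewrite (e_ext (e := e) _ (fun w => indic A w * (K + a + INR m * a)))
      by (intros w; rewrite S_INR; ring).
    eapply Rle_trans; [exact IH|].
    pose proof (cond_step (n + m) A (fun w => K + psum (fun i => X (n + i)%nat) m w)) as h.
    rewrite (e_ext (e := e) _ (fun w => indic A w * (K + a + psum (fun i => X (n + i)%nat) m w))) in h
      by (intros w; ring).
    eapply Rle_trans; [apply h|].
    + apply (filtration_mono n); [lia|exact hA].
    + split; [apply (H_plus U); [apply (H_const U)|apply hS]|].
      apply (meas_plus (filtration_sa _)); [apply meas_const, filtration_sa|apply hS].
    + apply Req_le, e_ext; intros w; simpl; ring.
Qed.

(** The event that the averages have nonpositive upper limit, with countable quantifiers only and
    the denominators cleared. *)
Definition limsup_nonpos (w : Om) : Prop := forall j, exists m, forall k, (m <= k)%nat ->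
  psum X (S k) w <= / INR (S j) * INR (S k).

(** For [A] close to this event and known at time [p], the increment over the next [m] steps has
    expectation on [A] at least [m a V(A)], but at most [10 eta m]. *)
Lemma limsup_nonpos_null : assumption_A F E -> 0 < a -> F limsup_nonpos /\ e (indic limsup_nonpos) = 0.
Proof.
  intros HA ha; set (B := limsup_nonpos).
  pose proof (adm_H _ _ _ _ hX) as hH.
  assert (hmX : forall i, measurable F (X i)) by (intros i; apply (H_meas U), hH).
  pose (G := fun A => exists n (r : R), A = (fun w => X n w <= r)).
  assert (hBG : sigma_gen G B).
  { pose proof (sigma_gen_sa G) as hsa.
    apply (sa_cinter hsa (fun j w => exists m, forall k, (m <= k)%nat ->
      psum X (S k) w <= / INR (S j) * INR (S k))); intros j.
    apply (sa_cunion hsa (fun m w => forall k, (m <= k)%nat ->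
      psum X (S k) w <= / INR (S j) * INR (S k))); intros m.
    apply (sa_cinter hsa (fun k w => (m <= k)%nat ->
      psum X (S k) w <= / INR (S j) * INR (S k))); intros k.
    apply (sa_ext _ (fun w => ~ (m <= k)%nat \/
      sum_f_R0 (fun i => X i w) k <= / INR (S j) * INR (S k))).
    - apply (sa_or hsa); [apply (sa_const hsa)|].
      apply (meas_sum hsa); intros i _ r; apply sigma_gen_base; exists i, r; reflexivity.
    - intros w; rewrite psum_sum; destruct (le_dec m k); tauto. }
  pose proof filtration_top as Fsa.
  assert (hBF : F B).
  { apply (sigma_gen_sub G F B Fsa); [|exact hBG].
    intros C [n [r ->]]; apply hmX. }
  split; [exact hBF|].
  destruct (HA X hmX B hBG) as [Bn [hBn hcv]].
  apply Rle_antisym; [|apply (V_nonneg U), hBF].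
  apply Rle_plus_epsilon; intros eps heps; rewrite Rplus_0_l.
  (* Chosen so that the final bound [(10 / a) eta + eta] equals [eps]. *)
  pose (eta := eps / (10 / a + 1)).
  assert (h10 : 0 < 10 / a) by (apply Rdiv_lt_0_compat; lra).
  assert (heta : 0 < eta) by (apply Rdiv_lt_0_compat; lra).
  destruct (e_excess U (X 0%nat) eta (hH 0%nat) heta) as [L hL].
  specialize (hL L (le_n _)); pose proof (pos_INR L) as hL0.
  (* An event of capacity at most [th] contributes at most [eta] even when weighted by [L]. *)
  pose (th := eta / (INR L + 1)).
  assert (hth : 0 < th) by (apply Rdiv_lt_0_compat; lra).
  assert (hLth : INR L * th + th = eta) by (unfold th; field; lra).
  destruct (hcv w0 th hth) as [n hn]; specialize (hn n (le_n _)).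
  set (A := Bn n) in *; unfold Rdist in hn; rewrite Rminus_0_r in hn.
  assert (hA : Ft (S n) A).
  { apply (sigma_gen_sub _ _ _ (filtration_sa (S n))) with (2 := hBn n).
    intros C [k [r [hk ->]]]; apply (filtration_mono (S k)); [lia|apply hX]. }
  set (p := S n) in hA.
  pose proof (filtration_sub _ _ hA) as hAF.
  assert (hDel : F (symdiff A B)).
  { apply (sa_or Fsa (fun w => A w /\ ~ B w)); apply (sa_and Fsa); auto; apply (sa_compl Fsa); assumption. }
  assert (hVdel : e (indic (symdiff A B)) < th).
  { eapply Rle_lt_trans; [apply Rle_abs|exact hn]. }
  (* The part of [B] where the averages still exceed [eta] at some index from [M] on; it decreases
     to the empty set. *)
  pose (D := fun M w => B w /\ exists k, (M <= k)%nat /\ eta * INR (S k) < psum X (S k) w).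
  assert (hHs : forall k, H (psum X k)).
  { intros k; induction k; simpl; [apply (H_const U)|apply (H_plus U); auto]. }
  assert (hD : forall M, F (D M)).
  { intros M; apply (sa_and Fsa); [exact hBF|].
    apply (sa_cunion Fsa (fun k w => (M <= k)%nat /\ eta * INR (S k) < psum X (S k) w)); intros k.
    apply (sa_and Fsa); [apply (sa_const Fsa)|].
    apply (meas_gt Fsa), (H_meas U), hHs. }
  destruct (V_down U D th hD) as [N hN]; [| |exact hth|].
  { intros M w [hw [k [hk hk']]]; split; [exact hw|exists k; split; [lia|exact hk']]. }
  { intros w; destruct (archimed_cor1 eta heta) as [j [hj hj0]].
    destruct (classic (B w)) as [hw|hw]; [|exists 0%nat; intros [h _]; tauto].
    destruct (hw (pred j)) as [m hm]; exists m; intros [_ [k [hk hk']]].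
    specialize (hm k hk); replace (S (pred j)) with j in hm by lia.
    pose proof (lt_0_INR (S k) ltac:(lia)); nra. }
  destruct (INR_unbounded (e (fun w => Rabs (psum X p w)) / eta)) as [m1 hm1].
  (* The three summands give [p + m <= 2 m], place [k] beyond [N], and make the expectation of
     [|S_p|] at most [eta m]. *)
  pose (m := (p + N + m1)%nat).
  assert (hk : (p + m = S (n + m))%nat) by reflexivity.
  set (k := (n + m)%nat) in hk.
  specialize (hN k ltac:(unfold k, m; lia)).
  assert (hmp : 0 < INR m) by (apply lt_0_INR; unfold m, p; lia).
  assert (hpm : INR p <= INR m) by (apply le_INR; unfold m; lia).
  assert (hkm : INR (S k) = INR p + INR m) by (rewrite <- hk; apply plus_INR).
  assert (hexc : forall i, H (fun w => Rmax (X i w - INR L) 0)).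
  { intros i; apply (H_max0 U), (H_minus U); [apply hH|apply (H_const U)]. }
  (* A majorant of the increment on [A]. Off the two exceptional sets the total sum is at most
     [eta (k + 1)]; on them each summand is bounded by [L] plus its excess over [L]. *)
  pose (Y := fun w => Rabs (psum X p w) + (INR (S k) * (INR L * indic (symdiff A B) w
    + INR L * indic (D k) w + eta) + sum_f_R0 (fun i => Rmax (X i w - INR L) 0) k)).
  assert (hY : H Y /\ e Y <= eta * INR m + (INR (S k) * (INR L * th + INR L * th + eta)
    + INR (S k) * eta)).
  { apply (e_plus_le U); [split; [apply (H_abs U), hHs|]|apply (e_plus_le U)].
    - apply (Rmult_lt_compat_r eta) in hm1; [|exact heta].
      unfold Rdiv in hm1; rewrite Rmult_assoc, Rinv_l, Rmult_1_r in hm1 by lra.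
      assert (INR m1 <= INR m) by (apply le_INR; unfold m; lia); nra.
    - apply (e_scal_le U); [apply pos_INR|].
      apply (e_plus_le U); [apply (e_plus_le U); apply (e_scal_le U); auto|].
      + split; [apply (H_indic U), hDel|lra].
      + split; [apply (H_indic U), hD|lra].
      + split; [apply (H_const U)|apply Req_le, (ue_const _ _ _ U)].
    - split; [apply (H_sum U (fun i w => _)), hexc|].
      eapply Rle_trans; [apply (e_sum_le U (fun i w => _)), hexc|].
      rewrite Rmult_comm, <- (sum_cte eta k); apply sum_Rle; intros i _.
      rewrite (adm_ident _ _ _ _ hX i (fun x => Rmax (x - INR L) 0)); [lra| |apply hexc|apply hexc].
      apply (meas_max0 borel_sa), (meas_plus borel_sa); [apply borel_id|apply (meas_const borel_sa)]. }
  assert (hlow : INR m * a * e (indic A) <= e Y).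
  { rewrite <- (ue_hom _ _ _ U) by ((apply (H_indic U); exact hAF) || nra).
    pose proof (block_lower p m A 0 hA) as hb.
    rewrite (e_ext (e := e) _ (fun w => INR m * a * indic A w)) in hb by (intros w; ring).
    eapply Rle_trans; [exact hb|].
    assert (hblock : forall w, psum (fun i => X (p + i)%nat) m w = psum X (S k) w - psum X p w).
    { intros w; rewrite <- hk, psum_split; ring. }
    rewrite (e_ext (e := e) _ (fun w => indic A w * (psum X (S k) w - psum X p w)))
      by (intros w; rewrite hblock; ring).
    apply (ue_mono _ _ _ U); [apply (H_indmul U); [exact hAF|apply (H_minus U); apply hHs]|apply hY|].
    intros w; unfold Y.
    assert (hs : psum X (S k) w <= INR (S k) * INR L + sum_f_R0 (fun i => Rmax (X i w - INR L) 0) k).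
    { rewrite psum_sum, Rmult_comm, <- (sum_cte (INR L) k), <- plus_sum.
      apply sum_Rle; intros i _; pose proof (Rmax_l (X i w - INR L) 0); lra. }
    assert (hs0 : 0 <= sum_f_R0 (fun i => Rmax (X i w - INR L) 0) k).
    { apply cond_pos_sum; intros i; apply Rmax_r. }
    pose proof (Rle_abs (- psum X p w)) as hab; rewrite Rabs_Ropp in hab.
    pose proof (Rabs_pos (psum X p w)).
    assert (hkp : 0 < INR (S k)) by (apply lt_0_INR; lia).
    assert (hkL : 0 <= INR (S k) * INR L) by nra.
    assert (hke : 0 <= INR (S k) * eta) by nra.
    destruct (indic_cases A w) as [[hw ->]|[hw ->]].
    - destruct (indic_cases (symdiff A B) w) as [[hd ->]|[hd ->]],
        (indic_cases (D k) w) as [[hd' ->]|[hd' ->]]; try lra.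
      assert (hwB : B w) by (apply NNPP; intros h; apply hd; left; tauto).
      enough (psum X (S k) w <= eta * INR (S k)) by lra.
      apply Rnot_lt_le; intros h; apply hd'; split; [exact hwB|exists k; auto].
    - destruct (indic_cases (symdiff A B) w) as [[hd ->]|[hd ->]],
        (indic_cases (D k) w) as [[hd' ->]|[hd' ->]]; lra. }
  assert (hVA : a * e (indic A) <= 10 * eta).
  (* The terms add up to at most [(1 + 6 + 2) eta m], below [10 eta m]. *)
  { destruct hY as [_ hY].
    assert (h1 : INR L * th + INR L * th + eta <= 3 * eta) by lra.
    assert (h2 : INR (S k) <= 2 * INR m) by lra.
    pose proof (Rmult_le_compat_l (INR (S k)) _ _ (pos_INR _) h1) as h3.
    assert (h4 : INR (S k) * eta <= 2 * INR m * eta) by (apply Rmult_le_compat_r; lra).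
    assert (h5 : 0 < INR m * eta) by (apply Rmult_lt_0_compat; assumption).
    apply (Rmult_le_reg_l (INR m)); [exact hmp|lra]. }
  apply Rle_trans with (e (indic A) + e (indic (symdiff A B))).
  - apply (V_or U); auto; intros w hw; unfold symdiff; destruct (classic (A w)); tauto.
  - assert (h1 : e (indic A) <= 10 / a * eta).
    { apply (Rmult_le_reg_l a); [exact ha|].
      replace (a * (10 / a * eta)) with (10 * eta) by (field; lra); exact hVA. }
    replace eps with (10 / a * eta + eta); [nra|unfold eta; field; lra].
Qed.

End Sequence.

(** Subtracting [c j] leaves the positive mean [1 / (j + 1)], so quasi-surely the shifted averages
    do not have nonpositive upper limit. A limit [Xl <= c j] would contradict this, and [c j] tends
    to the mean. *)
Lemma limit_ge_mean X Xl : admissible Ft H e X -> assumption_A F E ->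
  quasi_surely F e (fun w => Un_cv (fun n => sum_f_R0 (fun i => X i w) n / INR (S n)) (Xl w)) ->
  quasi_surely F e (fun w => e (X 0%nat) <= Xl w).
Proof.
  intros hX HA hcv.
  pose (c := fun j => e (X 0%nat) - / INR (S j)).
  apply (quasi_surely_and U) with (3 := hcv) (P := fun w => forall j,
    ~ limsup_nonpos (X := fun i w => X i w - c j) w).
  - intros w hw hl; apply Rle_plus_epsilon; intros eps heps.
    destruct (archimed_cor1 eps heps) as [j [hj hj0]].
    apply Rnot_lt_le; intros hlt; apply (hw (pred j)); intros i.
    destruct (hl (/ INR (S i)) (inv_INR_S_pos i)) as [m hm]; exists m; intros k hk.
    specialize (hm k hk); unfold Rdist in hm.
    assert (hp : 0 < INR (S k)) by (apply lt_0_INR; lia).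
    assert (hc : Xl w <= c (pred j)).
    { unfold c; replace (S (pred j)) with j by lia; lra. }
    pose proof (Rle_abs (sum_f_R0 (fun i => X i w) k / INR (S k) - Xl w)) as hab.
    assert (hs : sum_f_R0 (fun i => X i w) k / INR (S k) <= c (pred j) + / INR (S i)) by lra.
    apply (Rmult_le_compat_r (INR (S k))) in hs; [|lra].
    unfold Rdiv in hs; rewrite Rmult_assoc, Rinv_l, Rmult_1_r in hs by lra.
    rewrite psum_sum, minus_sum, sum_cte; lra.
  - apply (quasi_surely_all U); intros j.
    assert (hX' : admissible Ft H e (fun i w => X i w - c j)).
    { apply (adm_comp filtration_sa X (fun x => x - c j) hX).
      - apply (meas_plus borel_sa); [apply borel_id|apply (meas_const borel_sa)].
      - intros i; apply (H_minus U); [apply hX|apply (H_const U)]. }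
    assert (hc : e (fun w => X 0%nat w - c j) = / INR (S j)).
    { pose proof (e_translate U (X 0%nat) (- c j) (adm_H _ _ _ _ hX 0)) as h.
      change (e (fun w => X 0%nat w - c j) = e (X 0%nat) + - c j) in h.
      rewrite h; unfold c; ring. }
    destruct (limsup_nonpos_null hX' HA) as [h1 h2].
    { change (0 < e (fun w => X 0%nat w - c j)); rewrite hc; apply inv_INR_S_pos. }
    exists (limsup_nonpos (X := fun i w => X i w - c j)); auto.
Qed.

Lemma admissible_of_indep X : (forall i, Ht Ft H (S i) (X i)) ->
  (forall i, indep_sigma H E (X i) (Ft i)) -> (forall i j, ident_distr H E (X i) (X j)) ->
  admissible Ft H e X.
Proof.
  intros hm hind hid; split.
  - intros i; apply hm.
  - intros i; apply hm.
  - intros i A h hA hh hH.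
    assert (hAF := filtration_sub _ _ hA).
    (* The threshold 1/2 separates the two values of [indic A], so [phi (indic A w) y] is the
       product [indic A w * h y], and measurability of [phi] follows from [meas_if]. *)
    pose (phi := fun z y => if Rle_dec z (1 / 2) then 0 else h y).
    assert (hphi : forall w y, phi (indic A w) y = indic A w * h y).
    { intros w y; unfold phi; destruct (Rle_dec (indic A w) (1 / 2)) as [hz|hz],
        (indic_cases A w) as [[_ h1]|[_ h1]]; rewrite h1 in *; lra. }
    assert (hb : borel_fun2 phi).
    { apply (meas_if borel2_sa (fun p => fst p <= 1 / 2) (fun _ => 0) (fun p => h (snd p))
        (fun p => Rle_dec (fst p) (1 / 2))).
      - apply borel2_fst.
      - apply (meas_const borel2_sa).
      - apply (meas_comp borel2_sa); [exact hh|apply borel2_snd]. }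
    assert (h1 : H (fun w => phi (indic A w) (X i w))).
    { apply (H_ext (fun w => indic A w * h (X i w))); [apply (H_indmul U); assumption|].
      intros w; symmetry; apply hphi. }
    assert (h2 : forall z, H (fun w => phi z (X i w))).
    { intros z; unfold phi; destruct (Rle_dec z (1 / 2)); [apply (H_const U)|exact hH]. }
    pose proof (hind i A hA phi hb h1 h2 w0) as h3.
    change (e (fun w => phi (indic A w) (X i w))
      = e (fun w => e (fun w' => phi (indic A w) (X i w')))) in h3.
    rewrite (e_ext (e := e) _ (fun w => indic A w * h (X i w))) in h3 by (intros w; apply hphi).
    rewrite h3; apply e_ext; intros w; unfold phi.
    destruct (Rle_dec (indic A w) (1 / 2)) as [hz|hz],
      (indic_cases A w) as [[_ h4]|[_ h4]]; rewrite h4 in *; try lra.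
    rewrite (ue_const _ _ _ U); ring.
  - intros i h hh h1 h2; apply hid; assumption.
Qed.

Lemma qs_iff P : qs F E P <-> quasi_surely F e P.
Proof.
  split.
  - intros (N & hN & h0 & h); exists N; split; [exact hN|split; [apply (h0 w0)|exact h]].
  - intros (N & hN & h0 & h); exists N; split; [exact hN|split; [|exact h]].
    intros w; unfold capV; rewrite SL_const; [exact h0|apply (H_indic U), hN].
Qed.

End SublinearLaw.

(** * Convergence from one-sided bounds and proof of the theorem *)

Lemma Un_cv_of_one_sided (u : nat -> R) l :
  (forall j, exists N, forall n, (N <= n)%nat -> u n <= l + / INR (S j)) ->
  (forall j, exists N, forall n, (N <= n)%nat -> - u n <= - l + / INR (S j)) -> Un_cv u l.
Proof.
  intros h1 h2 eps heps; destruct (archimed_cor1 eps heps) as [j [hj hj0]].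
  destruct (h1 (pred j)) as [N1 hN1], (h2 (pred j)) as [N2 hN2].
  replace (S (pred j)) with j in * by lia.
  exists (Nat.max N1 N2); intros n hn; specialize (hN1 n ltac:(lia)); specialize (hN2 n ltac:(lia)).
  unfold Rdist; apply Rabs_def1; lra.
Qed.

Lemma sum_opp (f : nat -> R) n : sum_f_R0 (fun i => - f i) n = - sum_f_R0 f n.
Proof. induction n as [|n IH]; simpl; [reflexivity|rewrite IH; ring]. Qed.

(* X i stands for the paper's X_{i+1}; sum_f_R0 (fun i => X i w) n = S_{n+1}(w). *)
Theorem mainTheorem10 (Om : Type) (F : (Om -> Prop) -> Prop)
  (Ft : nat -> (Om -> Prop) -> Prop) (H : (Om -> R) -> Prop)
  (E : nat -> (Om -> R) -> (Om -> R))
  (HF : filtration F Ft) (HH : is_space F H) (HE : SL_expectation Ft H E)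
  (X : nat -> Om -> R)
  (HXm : forall i, Ht Ft H (S i) (X i))
  (HXind : forall i, indep_sigma H E (X i) (Ft i))
  (HXid : forall i j, ident_distr H E (X i) (X j))
  (Hsum : forall w, exists l : R,
     Un_cv (fun n => sum_f_R0 (fun k =>
        E 0%nat (fun w' => Rabs (X 0%nat w') *
              indic (fun w'' => INR k < Rabs (X 0%nat w'') <= INR (S k)) w') w) n) l) :
  ((forall w, E 0%nat (X 0%nat) w = - E 0%nat (fun w' => - X 0%nat w') w) ->
     qs F E (fun w => Un_cv (fun n => sum_f_R0 (fun i => X i w) n / INR (S n))
                            (E 0%nat (X 0%nat) w)))
  /\
  (forall Xl : Om -> R, H Xl -> assumption_A F E ->
     qs F E (fun w => Un_cv (fun n => sum_f_R0 (fun i => X i w) n / INR (S n)) (Xl w)) ->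
     (forall w, E 0%nat (X 0%nat) w = - E 0%nat (fun w' => - X 0%nat w') w) /\
     qs F E (fun w => Xl w = E 0%nat (X 0%nat) w)).
Proof.
  (* Reading [E 0] as a number requires a point of [Om]; on an empty space all claims are
     vacuous. *)
  destruct (classic (inhabited Om)) as [[w0]|hOm].
  2: { assert (hq : forall P, qs F E P).
       { intros P; exists (fun _ => True); split; [apply (filtration_top HF)|].
         split; intros w; destruct hOm; exact (inhabits w). }
       split; [intros _; apply hq|intros Xl _ _ _; split; [|apply hq]].
       intros w; destruct hOm; exact (inhabits w). }
  pose (e := fun Y : Om -> R => E 0%nat Y w0).
  pose proof (SL_upper_exp HF HH HE w0) as U; fold e in U.
  assert (hX : admissible Ft H e X) by (apply (admissible_of_indep HF HH HE w0); assumption).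
  assert (hX' : admissible Ft H e (fun i w => - X i w)).
  { apply (adm_comp (filtration_sa HF) X Ropp hX).
    - apply (meas_opp borel_sa), borel_id.
    - intros i; apply (H_opp U), HXm. }
  assert (hconst : forall Y w, H Y -> E 0%nat Y w = e Y) by (apply (SL_const HF HE)).
  assert (hH0 : H (X 0%nat)) by apply HXm.
  assert (hH0' : H (fun w => - X 0%nat w)) by (apply (H_opp U), hH0).
  assert (hneg : forall w n, sum_f_R0 (fun i => - X i w) n / INR (S n)
    = - (sum_f_R0 (fun i => X i w) n / INR (S n))).
  { intros w n; rewrite sum_opp; unfold Rdiv; ring. }
  split.
  - intros hmean; apply (qs_iff HF HH HE w0).
    assert (hm : e (X 0%nat) = - e (fun w => - X 0%nat w)) by apply hmean.
    destruct (Hsum w0) as [l hl].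
    assert (hB : forall n, sum_f_R0 (fun k => e (fun w => Rabs (X 0%nat w) *
      indic (shell (X 0%nat) k) w)) n <= l).
    { intros n; revert n; apply growing_ineq; [|exact hl].
      intros n; rewrite tech5; pose proof (shell_mass_nonneg U hX (S n)); lra. }
    assert (hB' : forall n, sum_f_R0 (fun k => e (fun w => Rabs (- X 0%nat w) *
      indic (shell (fun w => - X 0%nat w) k) w)) n <= l).
    { intros n; rewrite (sum_eq _ (fun k => e (fun w => Rabs (X 0%nat w) *
        indic (shell (X 0%nat) k) w))); [apply hB|].
      intros k _; apply (e_ext (e := e)); intros w; rewrite Rabs_Ropp; f_equal.
      f_equal; apply set_ext; intros v; unfold shell; rewrite Rabs_Ropp; tauto. }
    (* The tolerances [1 / (j + 1)] form a countable family, so their exceptional sets can be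
       united. *)
    apply (quasi_surely_and U) with
      (P := fun w => forall j, exists N, forall n, (N <= n)%nat ->
        sum_f_R0 (fun i => X i w) n / INR (S n) <= e (X 0%nat) + / INR (S j))
      (Q := fun w => forall j, exists N, forall n, (N <= n)%nat ->
        sum_f_R0 (fun i => - X i w) n / INR (S n) <= e (fun w => - X 0%nat w) + / INR (S j)).
    + intros w h1 h2; rewrite hconst by exact hH0; apply Un_cv_of_one_sided; [exact h1|].
      intros j; destruct (h2 j) as [N hN]; exists N; intros n hn.
      rewrite <- hneg, hm, Ropp_involutive; apply hN, hn.
    + apply (quasi_surely_all U); intros j.
      apply (upper_lln U (filtration_sa HF) (filtration_mono HF) (filtration_sub HF) hX l);
        [exact hB|apply inv_INR_S_pos].
    + apply (quasi_surely_all U); intros j.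
      apply (upper_lln U (filtration_sa HF) (filtration_mono HF) (filtration_sub HF) hX' l);
        [exact hB'|apply inv_INR_S_pos].
  - intros Xl _ HA hcv; apply (qs_iff HF HH HE w0) in hcv.
    assert (hcv' : quasi_surely F e (fun w =>
      Un_cv (fun n => sum_f_R0 (fun i => - X i w) n / INR (S n)) (- Xl w))).
    { apply (quasi_surely_and U) with (2 := hcv) (3 := hcv); intros w h _.
      apply (Un_cv_ext (fun n => - (sum_f_R0 (fun i => X i w) n / INR (S n)))).
      - intros n; symmetry; apply hneg.
      - exact (CV_opp _ _ h). }
    pose proof (limit_ge_mean HF HH HE w0 X Xl hX HA hcv) as h1; fold e in h1.
    pose proof (limit_ge_mean HF HH HE w0 _ _ hX' HA hcv') as h2; fold e in h2.
    assert (hsub : e (X 0%nat) + e (fun w => - X 0%nat w) >= 0).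
    { apply Rle_ge, (e_opp_nonneg U), hH0. }
    (* A single point where [e X <= Xl <= - e (- X)] already compares the two means, and
       subadditivity gives the reverse inequality. *)
    assert (h : quasi_surely F e (fun w => e (X 0%nat) <= Xl w /\ e (fun w => - X 0%nat w) <= - Xl w)).
    { apply (quasi_surely_and U) with (2 := h1) (3 := h2); auto. }
    destruct (quasi_surely_witness U _ h) as [v hv].
    split.
    + intros w; rewrite !hconst by assumption; lra.
    + apply (qs_iff HF HH HE w0), (quasi_surely_and U) with (2 := h) (3 := h).
      intros w hw _; rewrite hconst by assumption; lra.
Qed.
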